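(* Let $\mathcal{R}=\mathcal{D}+[0,2]\vec{\mathbf{k}}$ be a duplex region. Then, for any domino tiling $t$ of $\mathcal{R}$, $$P_t'(1)=T^{\vec{\mathbf{i}}}(t)=T^{\vec{\mathbf{j}}}(t)=T^{\vec{\mathbf{k}}}(t),$$ where $P_t'(1)$ is the derivative at $q=1$ of the Laurent polynomial $P_t(q)\in\mathbb{Z}[q,q^{-1}]$ and $T^{\vec u}(t)$ is the $\vec u$-pretwist of $t$.
   Context: **Regions and tilings.** $\vec{\mathbf{i}},\vec{\mathbf{j}},\vec{\mathbf{k}}$ is the standard basis of $\mathbb{R}^3$ and $\Phi=\{\pm\vec{\mathbf{i}},\pm\vec{\mathbf{j}},\pm\vec{\mathbf{k}}\}$. A duplex region (with axis $\vec{\mathbf{k}}$) is a set $\mathcal{R}=\mathcal{D}+[0,2]\vec{\mathbf{k}}$, where $\mathcal{D}\subset\mathbb{R}^2\times\{0\}$ is a finite union of closed unit squares with vertices in $\mathbb{Z}^2\times\{0\}$, is simply connected, and has connected interior (in the plane). Closed unit cubes with vertices in $\mathbb{Z}^3$ are coloured in checkerboard fashion: $(x,y,z)+[0,1]^3$ with $(x,y,z)\in\mathbb{Z}^3$ is white if $x+y+z$ is even and black if it is odd. A domino is the union of two such cubes sharing a face; a tiling of $\mathcal{R}$ is a set of dominoes with pairwise disjoint interiors whose union is $\mathcal{R}$. **Pretwists.** For a domino $d$, $\vec v(d)\in\Phi$ is the center of the black cube of $d$ minus the center of the white cube of $d$. For $\vec u\in\Phi$, the open $\vec u$-shade of $d$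 is $\mathcal{S}^{\vec u}(d)=\operatorname{int}\big((d+[0,\infty)\vec u)\setminus d\big)$. The effect of $d_0$ on $d_1$ along $\vec u$ is $\tau^{\vec u}(d_0,d_1)=\frac14\det(\vec v(d_1),\vec v(d_0),\vec u)$ if $d_1\cap\mathcal{S}^{\vec u}(d_0)\neq\emptyset$, and $0$ otherwise. The $\vec u$-pretwist of a tiling $t$ is $T^{\vec u}(t)=\sum_{d_0,d_1\in t}\tau^{\vec u}(d_0,d_1)$ (sum over ordered pairs). **Graph and sock.** Let $G$ be the plane graph whose vertices are the $(x,y)\in\mathbb{Z}^2$ with $[x,x+1]\times[y,y+1]\times\{0\}\subset\mathcal{D}$, two vertices being adjacent if their Euclidean distance is $1$. A vertex $v=(x,y)\in\mathbb{Z}^2$ is white if $x+y$ is even and black if $x+y$ is odd; $\operatorname{color}(v)=1$ if $v$ is black and $-1$ if $v$ is white. A system of cycles, or sock, in $G$ is a directed subgraph of $G$ consisting solely of (pairwise vertex-disjoint) oriented simple cycles. The sock $s$ of a tiling $t$ is obtained as follows. Each domino of $t$ not parallel to $\vec{\mathbf{k}}$ projects to an edge of $G$ (the edge joining the two vertices corresponding to the two unit squares of its projection); orient the edge from its white vertex to its black vertex if the domino lies in the top floor ($1\le z\le 2$), and from its black vertex to its white vertex if it lies in the bottom floor ($0\le z\le 1$). These oriented edges form disjoint oriented cycles; discard the trivial cycles (those of length $2$, coming from two dominoes one exactly above the other). The remaining oriented simple cycles constitute $s$. Vertices of $G$ not in $s$ are called jewels. **The invariant $P_t$.** For a cycle $\gamma$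 of $s$, viewed as an oriented closed curve in $\mathbb{R}^2$, and a point $p$ not on $\gamma$, $\operatorname{wind}(\gamma,p)$ is the (counterclockwise-positive) winding number of $\gamma$ around $p$. Define $$P_t(q)=\sum_{v}\operatorname{color}(v)\,q^{\sum_{\gamma,\,v\notin\gamma}\operatorname{wind}(\gamma,v)},$$ where $v$ ranges over the vertices of $G$ and the sum in the exponent is over the cycles $\gamma$ of $s$ that do not contain $v$. *)

(* Defs.v *)
From HB Require Import structures.
From mathcomp Require Import all_boot all_order all_algebra finmap.
From mathcomp Require Import monalg.
From mathcomp Require Import all_classical all_reals all_analysis.

Set Implicit Arguments.
Unset Strict Implicit.
Unset Printing Implicit Defensive.

Import Order.TTheory GRing.Theory Num.Theory numFieldNormedType.Exports.

Local Open Scope classical_set_scope.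
Local Open Scope ring_scope.

(* Points of Z^n and R^n are row vectors; coordinates of R^3 are indexed by
   0, 1 and ord_max. *)

Definition embed (R : realType) (n : nat) (x : 'rV[int]_n) : 'rV[R]_n :=
  map_mx (fun k : int => k%:~R) x.

(* x + [0,1]^n: a closed unit square for n = 2, a closed unit cube for n = 3. *)
Definition cell (R : realType) (n : nat) (x : 'rV[int]_n) : set 'rV[R]_n :=
  [set p | forall i, embed R x 0 i <= p 0 i <= embed R x 0 i + 1].

Definition cell_center (R : realType) (n : nat) (x : 'rV[int]_n) : 'rV[R]_n :=
  embed R x + const_mx 2^-1.

Definition white (n : nat) (x : 'rV[int]_n) : bool := (2 %| \sum_i x 0 i)%Z.

(* Euclidean distance 1; for n = 3 this says that the cubes with corners x and y
   share a face. *)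
Definition adjacent (n : nat) (x y : 'rV[int]_n) : bool :=
  \sum_i (x 0 i - y 0 i) ^+ 2 == 1.

Definition path_connected (T : topologicalType) (R : realType) (A : set T) :=
  forall x y, A x -> A y -> exists f : R -> T,
    [/\ {within `[0, 1], continuous f}, f @` `[0, 1] `<=` A, f 0 = x & f 1 = y].

Definition null_homotopic (T : topologicalType) (R : realType) (A : set T)
    (f : R -> T) :=
  exists H : R * R -> T,
    [/\ {within `[0, 1] `*` `[0, 1], continuous H},
        H @` (`[0, 1] `*` `[0, 1]) `<=` A,
        (forall x, 0 <= x <= 1 -> H (0, x) = f x),
        (forall x, 0 <= x <= 1 -> H (1, x) = f 0) &
        forall s, 0 <= s <= 1 -> H (s, 0) = f 0 /\ H (s, 1) = f 0].

Definition simply_connected (T : topologicalType) (R : realType) (A : set T) :=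
  path_connected R A /\
  forall f : R -> T, {within `[0, 1], continuous f} -> f @` `[0, 1] `<=` A ->
    f 0 = f 1 -> null_homotopic A f.

(* The plane R^2 x {0} is identified with R^2. *)
Definition duplex_base (R : realType) (D : set 'rV[R]_2) :=
  [/\ exists V : {fset 'rV[int]_2}, D = \bigcup_(v in [set` V]) @cell R 2 v,
      simply_connected R D & connected D°].

(* D + [0,2]k *)
Definition duplex (R : realType) (D : set 'rV[R]_2) : set 'rV[R]_3 :=
  [set p | D (lsubmx (p : 'rV_(2 + 1))) /\ 0 <= p 0 ord_max <= 2].

(* A domino is encoded by the minimal corners of its two cubes, the white one
   first; domino_set is the domino itself. *)
Notation domino := ('rV[int]_3 * 'rV[int]_3)%type.

Definition is_domino (d : domino) : bool :=
  [&& white d.1, ~~ white d.2 & adjacent d.1 d.2].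

Definition domino_set (R : realType) (d : domino) : set 'rV[R]_3 :=
  @cell R 3 d.1 `|` @cell R 3 d.2.

Definition is_tiling (R : realType) (A : set 'rV[R]_3) (t : {fset domino}) :=
  [/\ forall d, d \in t -> is_domino d,
      forall d d', d \in t -> d' \in t -> d != d' ->
        (@domino_set R d)° `&` (@domino_set R d')° = set0 &
      \bigcup_(d in [set` t]) @domino_set R d = A].

Definition domino_vec (R : realType) (d : domino) : 'rV[R]_3 :=
  cell_center R d.2 - cell_center R d.1.

Definition shade (R : realType) (u : 'rV[R]_3) (d : domino) : set 'rV[R]_3 :=
  ([set x + r *: u | x in @domino_set R d & r in [set r | 0 <= r]]
     `\` @domino_set R d)°.

Definition det3 (R : realType) (a b c : 'rV[R]_3) : R :=
  \det (\matrix_(i < 3) nth 0 [:: a; b; c] i).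

Definition effect (R : realType) (u : 'rV[R]_3) (d0 d1 : domino) : R :=
  if `[< @domino_set R d1 `&` shade u d0 !=set0 >]
  then 4^-1 * det3 (domino_vec R d1) (domino_vec R d0) u else 0.

Definition pretwist (R : realType) (u : 'rV[R]_3) (t : {fset domino}) : R :=
  \sum_(d0 <- t) \sum_(d1 <- t) effect u d0 d1.

Definition vec_i (R : realType) : 'rV[R]_3 := delta_mx 0 0.
Definition vec_j (R : realType) : 'rV[R]_3 := delta_mx 0 1.
Definition vec_k (R : realType) : 'rV[R]_3 := delta_mx 0 ord_max.

Definition vertices (R : realType) (D : set 'rV[R]_2) : {fset 'rV[int]_2} :=
  fset_set [set v | @cell R 2 v `<=` D].

Definition color (v : 'rV[int]_2) : int := if white v then -1 else 1.

Definition project (x : 'rV[int]_3) : 'rV[int]_2 :=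
  lsubmx (x : 'rV_(2 + 1)).

Definition parallel_k (d : domino) : bool := project d.1 == project d.2.

Definition top_floor (d : domino) : bool :=
  (d.1 0 ord_max == 1) && (d.2 0 ord_max == 1).

(* The colours here are those of the vertices in Z^2: in the top floor, a white
   cube lies over a black vertex. *)
Definition domino_arc (d : domino) : 'rV[int]_2 * 'rV[int]_2 :=
  let a := project d.1 in
  let b := project d.2 in
  let wv := if white a then a else b in
  let bv := if white a then b else a in
  if top_floor d then (wv, bv) else (bv, wv).

(* A directed graph on Z^2 is given by its set of arcs. *)
Notation digraph := {fset 'rV[int]_2 * 'rV[int]_2}.

Definition arcs (t : {fset domino}) : digraph :=
  [fset domino_arc d | d in t & ~~ parallel_k d]%fset.

(* The cycles of length 2 consist of the arcs whose reversal is also an arc. *)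
Definition sock (t : {fset domino}) : digraph :=
  [fset a in arcs t | (a.2, a.1) \notin arcs t]%fset.

(* c = [:: x_0; ...; x_m] traverses the oriented simple cycle g with arcs
   (x_0, x_1), ..., (x_m, x_0). *)
Definition traverses (c : seq 'rV[int]_2) (g : digraph) :=
  [/\ c != [::], uniq c & g = [fset (x, next c x) | x in c]%fset].

Definition cycles (s : digraph) : {fset digraph} :=
  [fset g in fpowerset s | `[< exists c, traverses c g >]]%fset.

Definition on_cycle (v : 'rV[int]_2) (g : digraph) : bool :=
  has (fun a => (v == a.1) || (v == a.2)) g.

(* n is the winding number around p of the curve f, parametrised by [0,1]:
   (2 pi)^-1 times the variation of a continuous argument of f - p. *)
Definition winding_number (R : realType) (f : R -> 'rV[R]_2) (p : 'rV[R]_2)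
    (n : int) :=
  exists theta : R -> R,
    [/\ {within `[0, 1], continuous theta},
        (forall x, 0 <= x <= 1 -> exists2 r, 0 < r &
           f x 0 0 - p 0 0 = r * cos (theta x) /\
           f x 0 1 - p 0 1 = r * sin (theta x)) &
        theta 1 - theta 0 = 2 * pi * n%:~R].

(* The closed polygonal curve with successive vertices x_0, ..., x_m, x_0, each
   edge being traversed in time 1 / (m + 1). *)
Definition polygon (R : realType) (c : seq 'rV[int]_2) (x : R) : 'rV[R]_2 :=
  let y := x * (size c)%:R in
  let k := Num.truncn y in
  let r := y - k%:R in
  (1 - r) *: embed R (nth 0 c (k %% size c)%N)
    + r *: embed R (nth 0 c (k.+1 %% size c)%N).

Definition wind (R : realType) (g : digraph) (v : 'rV[int]_2) : int :=
  xget 0 [set n | exists c, traverses c g /\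
    winding_number (@polygon R c) (embed R v) n].

(* Elements of Z[q, q^-1] are finitely supported functions on exponents. *)
Notation laurent := {malg int[int]}.

Definition laurent_deriv (f : laurent) : laurent :=
  \sum_(k <- msupp f) << k * f@_k *g (k - 1) >>.

Definition laurent_eval (R : realType) (f : laurent) (x : R) : R :=
  \sum_(k <- msupp f) (f@_k)%:~R * x ^ k.

Definition sock_poly (R : realType) (D : set 'rV[R]_2)
    (t : {fset domino}) : laurent :=
  \sum_(v <- vertices D)
    << color v *g \sum_(g <- cycles (sock t) | ~~ on_cycle v g) wind R g v >>.

(* Main.v *)
Require Import Defs.
From mathcomp Require Import all_boot all_order all_algebra finmap monalg.
From mathcomp Require Import all_classical all_reals all_analysis.
From mathcomp Require Import zify ring lra.

(** Everything is compared with winding numbers computed by counting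
    crossings. Call _cell_ (p, q) the unit square with lower left corner
    (p, q), so that the vertices of the graph are corners of cells. For a cycle
    of unit arcs, [crossings 0 1 p q] counts, with signs, the vertical arcs met
    by the ray that leaves the centre of the cell to the right. Around a vertex
    off the cycle the four cells agree ([crossings_corners]), and their common
    value is the winding number ([wind_crossings]). Hence the derivative at 1
    is the sum of color(v) E(v) over the vertices v, where E(v)
    ([winding_sum]) adds the winding numbers around v of the cycles of the sock
    that avoid v.

    Horizontal axes. Every domino that is not vertical gives the arc from its
    black cube to its white cube ([domino_arcE]). Along the axis i, an effect
    is nonzero only between a vertical domino and a domino parallel to j. For a
    given vertical domino over v, the dominoes parallel to j in its shade are
    the arcs that cross the rays to the right from the cells around v, and
    those in whose shade it lies are the arcs that cross the rays to the left;
    a closed curve crosses opposite rays equally often, with opposite signs.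
    So the pretwist is the sum of color(v) E(v) over the vertices v under
    vertical dominoes ([row_sum]). For the axis j the rays go upwards, and this
    only changes a sign ([crossings_arcs_swap]). The vertices on arcs
    contribute nothing to the sum of color(v) E(v): E takes the same value at
    the two ends of an arc, which have opposite colours ([sum_support0]).

    Vertical axis. The pretwist along k is a quarter of the sum of
    color(v) det(a, b) over the pairs of consecutive arcs a, b, where v is the
    vertex between them ([pair_sum_vertical]). For one cycle this is the sum of
    color(v) times its winding number around v, over the vertices off the cycle
    ([sum_turn]). Indeed the sum, over all v in the integer lattice, of
    color(v) times the numbers of the four cells around v vanishes, because the
    corners of a cell have alternating colours ([sum_color_all]); a vertex off
    the cycle contributes 4 color(v) times the winding number, and a vertex on
    it contributes - color(v) det(a, b), up to terms that cancel between the
    two ends of each arc ([crossings_on], [sum_color_on]).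

    Simple connectivity enters in this last step, which sums over all lattice
    points: those outside the graph must not contribute. If v is not a vertex
    of the graph, the cycle, moved to the centres of the squares of the
    base, is contracted in the base, hence without meeting the centre of the
    square of v, so its winding number there is 0 ([crossings_outside]). *)

Set Implicit Arguments.
Unset Strict Implicit.
Unset Printing Implicit Defensive.

Import Order.TTheory GRing.Theory Num.Theory numFieldNormedType.Exports.

Local Open Scope fset_scope.
Local Open Scope classical_set_scope.
Local Open Scope ring_scope.

(** * Crossings of a horizontal ray by lattice steps *)

Definition ind (b : bool) : int := if b then 1 else 0.

(** The contribution of the step from (x1, y1) to (x2, y2) to the crossings of
    the ray to the right from the centre of the cell (p, q). A unit step between
    the rows q and q + 1 is vertical, so the abscissa of its start decides. *)
Definition step_crossing (p q x1 y1 x2 y2 : int) : int :=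
  ind [&& p < x1, y1 == q & y2 == q + 1] - ind [&& p < x1, y1 == q + 1 & y2 == q].

Definition lattice_step (x1 y1 x2 y2 : int) : Prop :=
  [\/ x2 = x1 + 1 /\ y2 = y1, x2 = x1 - 1 /\ y2 = y1,
      x2 = x1 /\ y2 = y1 + 1 | x2 = x1 /\ y2 = y1 - 1].

Lemma indP (b : bool) : (b /\ ind b = 1) \/ (~~ b /\ ind b = 0).
Proof. by case: b; [left|right]. Qed.

(** Each indicator is decided by the context if possible and split otherwise,
    which keeps the number of cases small. *)
Ltac ind_lia :=
  rewrite ?/step_crossing;
  repeat match goal with |- context [ind ?b] =>
    let h := fresh in
    first [ have h : b = true by lia | have h : b = false by lia
          | case: (indP b) => -[h ->] ];
    rewrite ?h ?/(ind true) ?/(ind false)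
  end; lia.

(** Rays to the right and upwards bound a quadrant: a step crosses one of them
    exactly when it enters or leaves the quadrant. *)
Lemma step_crossing_swap p q x1 y1 x2 y2 : lattice_step x1 y1 x2 y2 ->
  step_crossing p q x1 y1 x2 y2 + step_crossing q p y1 x1 y2 x2 =
  ind ((p < x2) && (q < y2)) - ind ((p < x1) && (q < y1)).
Proof. move=> [|||] [-> ->]; ind_lia. Qed.

Lemma step_crossing_rev p q x1 y1 x2 y2 : lattice_step x1 y1 x2 y2 ->
  step_crossing p q x2 y2 x1 y1 = - step_crossing p q x1 y1 x2 y2.
Proof. move=> [|||] [-> ->]; ind_lia. Qed.

(** The rays from two neighbouring cells of a row differ by the edge between
    them. *)
Lemma step_crossing_left p q x1 y1 x2 y2 : lattice_step x1 y1 x2 y2 ->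
  step_crossing (p - 1) q x1 y1 x2 y2 - step_crossing p q x1 y1 x2 y2 =
  ind [&& x1 == p, x2 == p, y1 == q & y2 == q + 1]
  - ind [&& x1 == p, x2 == p, y1 == q + 1 & y2 == q].
Proof. move=> [|||] [-> ->]; ind_lia. Qed.

(** The rays from a cell and from the one below it bound a half-strip, which a
    step enters through one of the rays, through the edge between the cells, or
    along the line of lattice points in its middle. *)
Lemma step_crossing_down p q x1 y1 x2 y2 : lattice_step x1 y1 x2 y2 ->
  step_crossing p q x1 y1 x2 y2 - step_crossing p (q - 1) x1 y1 x2 y2 =
  ind [&& x1 == p, x2 == p + 1, y1 == q & y2 == q]
  - ind [&& x1 == p + 1, x2 == p, y1 == q & y2 == q]
  - (ind ((p < x2) && (y2 == q)) - ind ((p < x1) && (y1 == q))).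
Proof. move=> [|||] [-> ->]; ind_lia. Qed.

Lemma step_crossing_far p q x1 y1 x2 y2 : lattice_step x1 y1 x2 y2 -> p < x1 ->
  step_crossing p q x1 y1 x2 y2 = ind (q < y2) - ind (q < y1).
Proof. move=> [|||] [-> ->] h; ind_lia. Qed.

(** Counting the ends of a vertical step on the half-row to the right of (p, q)
    counts the step once for each of the two rays that it crosses. *)
Lemma step_crossing_right p q x1 y1 x2 y2 : lattice_step x1 y1 x2 y2 ->
  (y2 - y1) * (ind ((p < x1) && (y1 == q)) + ind ((p < x2) && (y2 == q))) =
  step_crossing p q x1 y1 x2 y2 + step_crossing p (q - 1) x1 y1 x2 y2.
Proof. move=> [|||] [-> ->]; ind_lia. Qed.

(** On the half-row to the left of (p, q) the steps that are counted are those
    that cross the two full lines but not the rays to the right. *)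
Lemma step_crossing_row p q x1 y1 x2 y2 : lattice_step x1 y1 x2 y2 ->
  ~ (x1 = p /\ y1 = q) -> ~ (x2 = p /\ y2 = q) ->
  (y2 - y1) * (ind ((x1 < p) && (y1 == q)) + ind ((x2 < p) && (y2 == q))) =
  - (step_crossing p q x1 y1 x2 y2 + step_crossing p (q - 1) x1 y1 x2 y2)
  + (ind (q < y2) - ind (q < y1)) + (ind (q - 1 < y2) - ind (q - 1 < y1)).
Proof. move=> [|||] [-> ->] h h'; ind_lia. Qed.

Lemma step_crossing_neq0 p q x1 y1 x2 y2 : step_crossing p q x1 y1 x2 y2 != 0 ->
  p < x1 /\ (q = y1 \/ q = y2).
Proof.
rewrite /step_crossing.
have [[h1 ->]|[h1 ->]] := indP [&& p < x1, y1 == q & y2 == q + 1].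
  by move=> _; split; lia.
by have [[h2 ->]|[h2 ->]] := indP [&& p < x1, y1 == q + 1 & y2 == q] => // _; split; lia.
Qed.

(** * Crossing numbers of lattice cycles *)

Lemma lattice_step_sqr (x1 y1 x2 y2 : int) :
  (x1 - x2) ^+ 2 + (y1 - y2) ^+ 2 = 1 -> lattice_step x1 y1 x2 y2.
Proof.
move=> h.
have : x1 - x2 = 0 \/ x1 - x2 = 1 \/ x1 - x2 = -1 by nia.
have : y1 - y2 = 0 \/ y1 - y2 = 1 \/ y1 - y2 = -1 by nia.
move: h => /[swap] -[|[|]] hy /[swap] -[|[|]] hx; rewrite hx hy => h //.
- by apply: Or42; lia.
- by apply: Or41; lia.
- by apply: Or44; lia.
- by apply: Or43; lia.
Qed.

Lemma ord2_cases (i j : 'I_2) : i != j -> (i = 0 /\ j = 1) \/ (i = 1 /\ j = 0).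
Proof.
case: i => [[|[|]]] // hi; case: j => [[|[|]]] // hj _;
  by [left; split; apply/val_inj | right; split; apply/val_inj].
Qed.

Lemma adjacent_step (u v : 'rV[int]_2) (i j : 'I_2) : i != j ->
  Defs.adjacent u v -> lattice_step (u 0 i) (u 0 j) (v 0 i) (v 0 j).
Proof.
move=> nij /eqP; rewrite big_ord_recl big_ord1.
have -> : lift ord0 ord0 = 1 :> 'I_2 by apply/val_inj.
by case: (ord2_cases nij) => -[-> ->] h; apply: lattice_step_sqr; rewrite -h // addrC.
Qed.

Lemma traverses_sum (V : zmodType) c g (F : _ -> V) : traverses c g ->
  \sum_(a <- g) F a = \sum_(x <- c) F (x, next c x).
Proof.
move=> [_ uc ->]; rewrite big_imfset /=; last by move=> x y _ _ [].
by rewrite undup_id.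
Qed.

Lemma traverses_mem c g a : traverses c g ->
  (a \in g) = (a.1 \in c) && (a.2 == next c a.1).
Proof.
move=> [_ uc ->]; apply/imfsetP/andP => [[x /= xc ->]|[h1 /eqP h2]]; first by split.
by exists a.1 => //; rewrite -h2; case: (a).
Qed.

Lemma perm_next (T : eqType) (c : seq T) : uniq c -> perm_eq (map (next c) c) c.
Proof.
move=> uc; have inj : injective (next c) by exact: can_inj (prev_next uc).
have um : uniq (map (next c) c) by rewrite map_inj_uniq.
have sub : {subset map (next c) c <= c} by move=> _ /mapP[x xc ->]; rewrite mem_next.
apply: uniq_perm => //; apply: (uniq_min_size um sub _).2.
by rewrite size_map.
Qed.

Lemma sum_next (V : zmodType) (T : eqType) (c : seq T) (F : T -> V) : uniq c ->
  \sum_(x <- c) F (next c x) = \sum_(x <- c) F x.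
Proof. by move=> uc; rewrite -[RHS](perm_big _ (perm_next uc)) /= big_map. Qed.

(** This makes every identity between crossings that holds up to a difference
    of values of a potential exact for closed cycles. *)
Lemma traverses_telescope (V : zmodType) c g (F : _ -> V) : traverses c g ->
  \sum_(a <- g) (F a.2 - F a.1) = 0.
Proof.
move=> tc; rewrite (traverses_sum _ tc) /= sumrB sum_next ?subrr //.
by case: tc.
Qed.

Lemma traverses_on_cycle c g v : traverses c g -> on_cycle v g = (v \in c).
Proof.
move=> tc; apply/hasP/idP => [[a]|vc].
  rewrite (traverses_mem _ tc) => /andP[a1 /eqP a2] /orP[/eqP->|/eqP->] //.
  by rewrite a2 mem_next.
by exists (v, next c v); rewrite ?(traverses_mem _ tc) /= ?vc ?eqxx.
Qed.

Notation lattice_arc := ('rV[int]_2 * 'rV[int]_2)%type.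

Definition crossing (i j : 'I_2) (p q : int) (a : lattice_arc) : int :=
  step_crossing p q (a.1 0 i) (a.1 0 j) (a.2 0 i) (a.2 0 j).

Definition crossings (i j : 'I_2) (p q : int) (g : digraph) : int :=
  \sum_(a <- g) crossing i j p q a.

Definition lattice_graph (g : digraph) := forall a, a \in g -> Defs.adjacent a.1 a.2.

Section Cycle.
Variables (c : seq 'rV[int]_2) (g : digraph).
Hypotheses (tc : traverses c g) (lg : lattice_graph g).

Let step (i j : 'I_2) a : i != j -> a \in g ->
  lattice_step (a.1 0 i) (a.1 0 j) (a.2 0 i) (a.2 0 j).
Proof. by move=> nij /lg; apply: adjacent_step. Qed.

Lemma crossings_swap p q : crossings 1 0 q p g = - crossings 0 1 p q g.
Proof.
apply/eqP; rewrite -addr_eq0 addrC -big_split /=; apply/eqP.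
rewrite -[RHS](traverses_telescope (fun v => ind ((p < v 0 0) && (q < v 0 1))) tc).
by apply: eq_big_seq => a ag; apply: step_crossing_swap; apply: step.
Qed.

Definition up_flow p q : int := \sum_(a <- g)
  (ind [&& a.1 0 0 == p, a.2 0 0 == p, a.1 0 1 == q & a.2 0 1 == q + 1]
   - ind [&& a.1 0 0 == p, a.2 0 0 == p, a.1 0 1 == q + 1 & a.2 0 1 == q]).
Definition right_flow p q : int := \sum_(a <- g)
  (ind [&& a.1 0 0 == p, a.2 0 0 == p + 1, a.1 0 1 == q & a.2 0 1 == q]
   - ind [&& a.1 0 0 == p + 1, a.2 0 0 == p, a.1 0 1 == q & a.2 0 1 == q]).

Lemma crossings_left p q :
  crossings 0 1 (p - 1) q g - crossings 0 1 p q g = up_flow p q.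
Proof.
rewrite -sumrB; apply: eq_big_seq => a /(@step 0 1 a isT).
by rewrite /crossing => /step_crossing_left ->.
Qed.

Lemma crossings_down p q :
  crossings 0 1 p q g - crossings 0 1 p (q - 1) g = right_flow p q.
Proof.
have := traverses_telescope (fun v => ind ((p < v 0 0) && (v 0 1 == q))) tc.
move=> /(congr1 (fun x => right_flow p q - x)); rewrite subr0 => <-.
rewrite -!sumrB; apply: eq_big_seq => a /(@step 0 1 a isT).
by rewrite /crossing => /step_crossing_down ->.
Qed.

(** A ray that starts to the left of the whole cycle is crossed as often as a
    full line, hence 0 times. *)
Lemma crossings_bounded : exists N : int, forall p q,
  crossings 0 1 p q g != 0 -> [/\ - N < p, p < N, - N < q & q < N].
Proof.
pose N : int := \sum_(a <- g) Posz (absz (a.1 0 0) + absz (a.1 0 1) + absz (a.2 0 1)).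
exists (N + 1) => p q.
have leN a : a \in g -> Posz (absz (a.1 0 0) + absz (a.1 0 1) + absz (a.2 0 1)) <= N.
  move=> ag; rewrite /N (big_fsetD1 a) //= lerDl; exact: sumr_ge0.
have ex (F : lattice_arc -> int) : \sum_(a <- g) F a != 0 -> exists2 a, a \in g & F a != 0.
  move=> h; apply/hasP; apply: contraNT h => /hasPn h.
  by rewrite big_seq big1 // => a /h; rewrite negbK => /eqP.
move=> nz; have [a ag h] := ex _ nz.
have h1 : p < a.1 0 0 /\ (q = a.1 0 1 \/ q = a.2 0 1) :=
  @step_crossing_neq0 p q _ _ (a.2 0 0) _ h.
have hp : - (N + 1) < p.
  rewrite ltNge; apply/negP => hp; move/eqP: nz; apply.
  rewrite -[RHS](traverses_telescope (fun v => ind (q < v 0 1)) tc).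
  apply: eq_big_seq => b bg; apply: step_crossing_far; first exact: step.
  have := leN _ bg; move: (b.1 0 0) (b.1 0 1) (b.2 0 1) => x y z; lia.
have := leN _ ag; move: h1 hp.
by move: (a.1 0 0) (a.1 0 1) (a.2 0 1) => x y z h1 hp hN; split=> //; lia.
Qed.

End Cycle.

(** * The four cells around a vertex *)

(** The sum of the values of F at the two cells on the sides of an edge. *)
Definition edge_cells (F : int -> int -> int) (x1 y1 x2 y2 : int) : int :=
  if y1 == y2 then F (Num.min x1 x2) y1 + F (Num.min x1 x2) (y1 - 1)
  else F x1 (Num.min y1 y2) + F (x1 - 1) (Num.min y1 y2).

Lemma edge_cells_right F x y :
  edge_cells F x y (x + 1) y = F x y + F x (y - 1).
Proof. by rewrite /edge_cells eqxx (_ : Num.min _ _ = x) //; lia. Qed.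

Lemma edge_cells_left F x y :
  edge_cells F x y (x - 1) y = F (x - 1) y + F (x - 1) (y - 1).
Proof. by rewrite /edge_cells eqxx (_ : Num.min _ _ = x - 1) //; lia. Qed.

Lemma edge_cells_up F x y :
  edge_cells F x y x (y + 1) = F x y + F (x - 1) y.
Proof.
have h : (y == y + 1) = false by lia.
have h' : Num.min y (y + 1) = y by lia.
by rewrite /edge_cells h h'.
Qed.

Lemma edge_cells_down F x y :
  edge_cells F x y x (y - 1) = F x (y - 1) + F (x - 1) (y - 1).
Proof.
have h : (y == y - 1) = false by lia.
have h' : Num.min y (y - 1) = y - 1 by lia.
by rewrite /edge_cells h h'.
Qed.

Lemma edge_cells_sym F x1 y1 x2 y2 : lattice_step x1 y1 x2 y2 ->
  edge_cells F x2 y2 x1 y1 = edge_cells F x1 y1 x2 y2.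
Proof.
move=> [|||] [-> ->].
- by have := edge_cells_left F (x1 + 1) y1; rewrite addrK edge_cells_right.
- by have := edge_cells_right F (x1 - 1) y1; rewrite subrK edge_cells_left.
- by have := edge_cells_down F x1 (y1 + 1); rewrite addrK edge_cells_up.
- by have := edge_cells_up F x1 (y1 - 1); rewrite subrK edge_cells_down.
Qed.

Definition four_cells (F : int -> int -> int) x y : int :=
  F x y + F (x - 1) y + F x (y - 1) + F (x - 1) (y - 1).

Definition turn (ux uy x y wx wy : int) : int :=
  (x - ux) * (wy - y) - (y - uy) * (wx - x).

Lemma step_ind x y ux uy : lattice_step x y ux uy ->
  let e := ind ((ux == x + 1) && (uy == y)) in
  let w := ind ((ux == x - 1) && (uy == y)) in
  let n := ind ((ux == x) && (uy == y + 1)) in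
  let s := ind ((ux == x) && (uy == y - 1)) in
  [\/ [/\ ux - x = 1 /\ uy - y = 0, e = 1, w = 0, n = 0 & s = 0],
      [/\ ux - x = -1 /\ uy - y = 0, e = 0, w = 1, n = 0 & s = 0],
      [/\ ux - x = 0 /\ uy - y = 1, e = 0, w = 0, n = 1 & s = 0] |
      [/\ ux - x = 0 /\ uy - y = -1, e = 0, w = 0, n = 0 & s = 1]].
Proof.
move=> h; have K (b : bool) : (b -> ind b = 1) /\ (~~ b -> ind b = 0) by case: b.
by case: h => -[-> ->] /=; [apply: Or41|apply: Or42|apply: Or43|apply: Or44];
  split; try apply K; lia.
Qed.

Lemma step_edge_cells F x y ux uy : lattice_step x y ux uy ->
  [\/ ux - x = 1 /\ edge_cells F x y ux uy = F x y + F x (y - 1),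
      ux - x = -1 /\ edge_cells F x y ux uy = F (x - 1) y + F (x - 1) (y - 1),
      uy - y = 1 /\ edge_cells F x y ux uy = F x y + F (x - 1) y |
      uy - y = -1 /\ edge_cells F x y ux uy = F x (y - 1) + F (x - 1) (y - 1)].
Proof.
case=> -[-> ->]; rewrite ?edge_cells_right ?edge_cells_left ?edge_cells_up ?edge_cells_down.
- by apply: Or41; split=> //; lia.
- by apply: Or42; split=> //; lia.
- by apply: Or43; split=> //; lia.
- by apply: Or44; split=> //; lia.
Qed.

(** The values a, b, c, d are those of the cells to the north-east, north-west,
    south-east and south-west of a vertex, (dx, dy) and (dx', dy') lead to its
    neighbours on a path, e, w, n, s and e', w', n', s' are the indicators of
    these directions, and M, M' are the sums over the sides of the two edges of
    the path. For each pair of directions the claim is linear. *)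
Lemma four_cells_lin (a b c d dx dy dx' dy' e w n s e' w' n' s' M M' : int) :
    [\/ [/\ dx = 1 /\ dy = 0, e = 1, w = 0, n = 0 & s = 0],
      [/\ dx = -1 /\ dy = 0, e = 0, w = 1, n = 0 & s = 0],
      [/\ dx = 0 /\ dy = 1, e = 0, w = 0, n = 1 & s = 0] |
      [/\ dx = 0 /\ dy = -1, e = 0, w = 0, n = 0 & s = 1]] ->
    [\/ [/\ dx' = 1 /\ dy' = 0, e' = 1, w' = 0, n' = 0 & s' = 0],
      [/\ dx' = -1 /\ dy' = 0, e' = 0, w' = 1, n' = 0 & s' = 0],
      [/\ dx' = 0 /\ dy' = 1, e' = 0, w' = 0, n' = 1 & s' = 0] |
      [/\ dx' = 0 /\ dy' = -1, e' = 0, w' = 0, n' = 0 & s' = 1]] ->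
    [\/ dx = 1 /\ M = a + c, dx = -1 /\ M = b + d,
        dy = 1 /\ M = a + b | dy = -1 /\ M = c + d] ->
    [\/ dx' = 1 /\ M' = a + c, dx' = -1 /\ M' = b + d,
        dy' = 1 /\ M' = a + b | dy' = -1 /\ M' = c + d] ->
    ~ (dx = dx' /\ dy = dy') ->
    b - a = n' - n -> d - c = s - s' -> a - c = e' - e -> b - d = w - w' ->
  a + b + c + d = M + M' - ((- dx) * dy' - (- dy) * dx').
Proof.
move=> [|||] [[-> ->] -> -> -> ->] [|||] [[-> ->] -> -> -> ->];
  try (by move=> _ _ []);
  move=> [|||] [] // _ -> [|||] [] // _ -> _; lia.
Qed.

(** If F changes by 1 across the path u, (x, y), w and by nothing across the
    other edges at (x, y), then the four cells at (x, y) are counted once by the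
    two edges of the path, except for a corner that a turn counts twice and the
    opposite one that it omits. *)
Lemma four_cells_turn F x y ux uy wx wy :
    lattice_step x y ux uy -> lattice_step x y wx wy -> ~ (ux = wx /\ uy = wy) ->
    F (x - 1) y - F x y = ind ((wx == x) && (wy == y + 1)) - ind ((ux == x) && (uy == y + 1)) ->
    F (x - 1) (y - 1) - F x (y - 1) =
      ind ((ux == x) && (uy == y - 1)) - ind ((wx == x) && (wy == y - 1)) ->
    F x y - F x (y - 1) = ind ((wx == x + 1) && (wy == y)) - ind ((ux == x + 1) && (uy == y)) ->
    F (x - 1) y - F (x - 1) (y - 1) =
      ind ((ux == x - 1) && (uy == y)) - ind ((wx == x - 1) && (wy == y)) ->
  four_cells F x y = edge_cells F x y ux uy + edge_cells F x y wx wy - turn ux uy x y wx wy.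
Proof.
move=> su sw nuw h1 h2 h3 h4.
have := four_cells_lin (step_ind su) (step_ind sw) (step_edge_cells F su)
  (step_edge_cells F sw) _ h1 h2 h3 h4.
rewrite !opprB; apply => -[h h']; apply: nuw; lia.
Qed.

Lemma lattice_step_sym x1 y1 x2 y2 :
  lattice_step x1 y1 x2 y2 -> lattice_step x2 y2 x1 y1.
Proof.
move=> [|||] [-> ->]; [apply: Or42|apply: Or41|apply: Or44|apply: Or43];
  by rewrite ?addrK ?subrK.
Qed.

Definition pt (x y : int) : 'rV[int]_2 := \row_k (if k == 0 then x else y).

Lemma pt0 x y : pt x y 0 0 = x. Proof. by rewrite mxE. Qed.
Lemma pt1 x y : pt x y 0 1 = y. Proof. by rewrite mxE. Qed.
Definition ptE := (pt0, pt1).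

Lemma ord2P (i : 'I_2) : i = 0 \/ i = 1.
Proof. by case: i => [[|[|]]] // hi; [left|right]; apply/val_inj. Qed.

Lemma rV2P (u v : 'rV[int]_2) : u 0 0 = v 0 0 -> u 0 1 = v 0 1 -> u = v.
Proof.
by move=> h0 h1; apply/rowP => k; have [->|->] := ord2P k.
Qed.

Lemma rV2_eqE (u v : 'rV[int]_2) : (u == v) = (u 0 0 == v 0 0) && (u 0 1 == v 0 1).
Proof.
apply/eqP/andP => [->|[/eqP h0 /eqP h1]]; [by rewrite !eqxx|exact: rV2P].
Qed.

Lemma whiteE (v : 'rV[int]_2) : white v = (2 %| (v 0 0 + v 0 1)%R)%Z.
Proof.
rewrite /white big_ord_recl big_ord1.
by have -> : lift ord0 ord0 = 1 :> 'I_2 by apply/val_inj.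
Qed.

Lemma color_step (u v : 'rV[int]_2) :
  lattice_step (u 0 0) (u 0 1) (v 0 0) (v 0 1) -> color v = - color u.
Proof.
rewrite /color !whiteE.
by move: (u 0 0) (u 0 1) (v 0 0) (v 0 1) => a b c d [|||] [-> ->]; do 2 case: ifP; lia.
Qed.

Lemma color_adjacent (u v : 'rV[int]_2) : Defs.adjacent u v -> color v = - color u.
Proof. by move/(@adjacent_step u v 0 1 isT)/color_step. Qed.

Section Cycle.
Variables (c : seq 'rV[int]_2) (g : digraph).
Hypotheses (tc : traverses c g) (lg : lattice_graph g).

Let W p q := crossings 0 1 p q g.

Lemma traverses_uniq : uniq c. Proof. by case: tc. Qed.

Lemma sum_ind_eq (e : lattice_arc) : \sum_(a <- g) ind (a == e) = ind (e \in g).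
Proof.
have [eg|eg] := boolP (e \in g).
  rewrite (big_fsetD1 e) //= eqxx big1_fset ?addr0 // => a.
  by rewrite !inE => /andP[/negbTE ->].
by rewrite big1_fset // => a ag _; case: eqP => // ae; rewrite -ae ag in eg.
Qed.

Lemma up_flowE p q : up_flow g p q =
  ind ((pt p q, pt p (q + 1)) \in g) - ind ((pt p (q + 1), pt p q) \in g).
Proof.
rewrite -!sum_ind_eq -sumrB; apply: eq_bigr => -[a b] _ /=.
by congr (ind _ - ind _); rewrite !xpair_eqE !rV2_eqE !ptE; lia.
Qed.

Lemma right_flowE p q : right_flow g p q =
  ind ((pt p q, pt (p + 1) q) \in g) - ind ((pt (p + 1) q, pt p q) \in g).
Proof.
rewrite -!sum_ind_eq -sumrB; apply: eq_bigr => -[a b] _ /=.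
by congr (ind _ - ind _); rewrite !xpair_eqE !rV2_eqE !ptE; lia.
Qed.

Lemma mem_out u v : v \in c -> ((v, u) \in g) = (u == next c v).
Proof. by move=> vc; rewrite (traverses_mem _ tc) /= vc. Qed.

Lemma mem_in u v : v \in c -> ((u, v) \in g) = (u == prev c v).
Proof.
move=> vc; rewrite (traverses_mem _ tc) /=.
apply/andP/eqP => [[_ /eqP ->]|->]; first by rewrite prev_next ?traverses_uniq.
by rewrite mem_prev vc next_prev ?traverses_uniq.
Qed.

Lemma mem_off u v : v \notin c -> (((u, v) \in g) = false) * (((v, u) \in g) = false).
Proof.
move=> vc; rewrite !(traverses_mem _ tc) /= (negbTE vc) /=; split=> //.
apply/negP => /andP[uc' /eqP vu]; by rewrite vu mem_next uc' in vc.
Qed.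

(** No arc separates the cells around a vertex off the cycle. *)
Lemma crossings_corners (v : 'rV[int]_2) : v \notin c ->
  [/\ W (v 0 0) (v 0 1) = W (v 0 0) (v 0 1 - 1),
      W (v 0 0 - 1) (v 0 1) = W (v 0 0) (v 0 1 - 1) &
      W (v 0 0 - 1) (v 0 1 - 1) = W (v 0 0) (v 0 1 - 1)].
Proof.
move=> vc; have ev : pt (v 0 0) (v 0 1) = v by apply: rV2P; rewrite ptE.
have := crossings_left lg (v 0 0) (v 0 1).
have := crossings_left lg (v 0 0) (v 0 1 - 1).
have := crossings_down tc lg (v 0 0) (v 0 1).
rewrite !up_flowE right_flowE !subrK !ev !(mem_off _ vc) /ind -!/(W _ _).
move: (W (v 0 0 - 1) (v 0 1 - 1)) (W (v 0 0 - 1) (v 0 1))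
  (W (v 0 0) (v 0 1 - 1)) (W (v 0 0) (v 0 1)) => *.
by split; lia.
Qed.

Lemma crossings_on (v : 'rV[int]_2) : v \in c -> prev c v != next c v ->
  let u := prev c v in let w := next c v in
  four_cells W (v 0 0) (v 0 1) =
    edge_cells W (u 0 0) (u 0 1) (v 0 0) (v 0 1) + edge_cells W (v 0 0) (v 0 1) (w 0 0) (w 0 1)
    - turn (u 0 0) (u 0 1) (v 0 0) (v 0 1) (w 0 0) (w 0 1).
Proof.
move=> vc nuw u w; have ev : pt (v 0 0) (v 0 1) = v by apply: rV2P; rewrite ptE.
have ug : (u, v) \in g by rewrite mem_in.
have wg : (v, w) \in g by rewrite mem_out.
have su := @adjacent_step _ _ 0 1 isT (lg ug).
have sw := @adjacent_step _ _ 0 1 isT (lg wg).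
rewrite -edge_cells_sym //; apply: four_cells_turn => //.
- exact: lattice_step_sym.
- by move=> [h0 h1]; move/eqP: nuw; apply; apply: rV2P.
- rewrite crossings_left // up_flowE !ev (mem_in _ vc) (mem_out _ vc).
  by rewrite !rV2_eqE !ptE; congr (ind (_ && _) - ind (_ && _)); exact: eq_sym.
- rewrite crossings_left // up_flowE subrK !ev (mem_in _ vc) (mem_out _ vc).
  by rewrite !rV2_eqE !ptE; congr (ind (_ && _) - ind (_ && _)); exact: eq_sym.
- rewrite (crossings_down tc lg) right_flowE !ev (mem_in _ vc) (mem_out _ vc).
  by rewrite !rV2_eqE !ptE; congr (ind (_ && _) - ind (_ && _)); exact: eq_sym.
- have := crossings_down tc lg (v 0 0 - 1) (v 0 1); rewrite -!/(W _ _) => ->.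
  rewrite right_flowE !subrK !ev (mem_in _ vc) (mem_out _ vc).
  by rewrite !rV2_eqE !ptE; congr (ind (_ && _) - ind (_ && _)); exact: eq_sym.
Qed.

End Cycle.

Definition vturn (u v w : 'rV[int]_2) : int :=
  turn (u 0 0) (u 0 1) (v 0 0) (v 0 1) (w 0 0) (w 0 1).

Lemma color_shift v : color (v - pt 1 0) = - color v.
Proof.
by apply: color_step; rewrite !mxE /= subr0; apply: Or42.
Qed.

(** Both sums are the sum over the whole lattice. *)
Lemma sum_translate (B : {fset 'rV[int]_2}) (F : 'rV[int]_2 -> int) e :
  (forall v, F v != 0 -> v \in B /\ v + e \in B) ->
  \sum_(v <- B) F (v - e) = \sum_(v <- B) F v.
Proof.
move=> supp.
have h1 v : v \notin B -> F v = 0.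
  by move=> vB; apply/eqP; apply: contraNT vB => /supp[].
have h2 v : v \notin B -> F (v - e) = 0.
  by move=> vB; apply/eqP; apply: contraNT vB => /supp[_]; rewrite subrK.
rewrite -[LHS](fsbigTE _ _ h2) -[RHS](fsbigTE _ _ h1) [RHS](@reindex_fsbigT _ _ _ _ _ (fun v => v - e)) //.
by exists (fun v => v + e) => v; rewrite ?addrK ?subrK.
Qed.

Definition box (N : nat) : {fset 'rV[int]_2} :=
  [fset pt (Posz i - Posz N) (Posz j - Posz N)
    | i in iota 0 (2 * N + 1), j in iota 0 (2 * N + 1)]%fset.

Lemma mem_box N (v : 'rV[int]_2) :
  - Posz N <= v 0 0 <= Posz N -> - Posz N <= v 0 1 <= Posz N -> v \in box N.
Proof.
move=> h0 h1; apply/imfset2P; exists (absz (v 0 0 + Posz N)).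
  rewrite /= mem_iota; move: (v 0 0) (v 0 1) h0 h1 => x y; lia.
exists (absz (v 0 1 + Posz N)).
  rewrite /= mem_iota; move: (v 0 0) (v 0 1) h0 h1 => x y; lia.
by apply: rV2P; rewrite ptE; move: (v 0 0) (v 0 1) h0 h1 => x y; lia.
Qed.

Section Cycle.
Variables (c : seq 'rV[int]_2) (g : digraph).
Hypotheses (tc : traverses c g) (lg : lattice_graph g).
Hypothesis noback : forall v, v \in c -> prev c v != next c v.

Let W p q := crossings 0 1 p q g.

(** The terms of [crossings_on] that belong to an edge of the cycle occur once
    for each of its ends, with opposite colours. *)
Lemma sum_color_on :
  \sum_(v <- c) color v * four_cells W (v 0 0) (v 0 1) =
  - \sum_(v <- c) color v * vturn (prev c v) v (next c v).
Proof.
have uc := traverses_uniq tc.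
pose M (u v : 'rV[int]_2) := edge_cells W (u 0 0) (u 0 1) (v 0 0) (v 0 1).
have -> : \sum_(v <- c) color v * four_cells W (v 0 0) (v 0 1) =
    \sum_(v <- c) (color v * M (prev c v) v + color v * M v (next c v)
                   - color v * vturn (prev c v) v (next c v)).
  apply: eq_big_seq => v vc; rewrite (crossings_on tc lg vc (noback vc)).
  by rewrite mulrBr mulrDr.
rewrite sumrB big_split /= -(sum_next (fun v => color v * M (prev c v) v) uc).
rewrite -[RHS]add0r; congr (_ - _).
rewrite -big_split big_seq big1 //= => v vc; rewrite (prev_next uc).
have vg : (v, next c v) \in g by rewrite (mem_out tc).
by rewrite (color_adjacent (lg vg)) mulNr addNr.
Qed.

(** The neighbours v and v - (1, 0) have opposite colours and share two cells, so the sum telescopes along the rows. *)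
Lemma sum_color_all : exists2 B : {fset 'rV[int]_2},
  (forall v : 'rV[int]_2, W (v 0 0) (v 0 1 - 1) != 0 -> v \in B) & {subset c <= B} /\
  \sum_(v <- B) color v * four_cells W (v 0 0) (v 0 1) = 0.
Proof.
have [N hN] := crossings_bounded tc lg.
pose K := \sum_(v <- c) (absz (v 0%R 0%R) + absz (v 0%R 1%R))%N.
pose B := box (absz N + K + 2)%N.
have memB (v : 'rV[int]_2) :
    [/\ - N - 2 < v 0 0, v 0 0 < N + 2, - N - 2 < v 0 1 & v 0 1 < N + 2] -> v \in B.
  move: (mem_box (N := (absz N + K + 2)%N) (v := v)); rewrite -/B.
  move: (v 0 0) (v 0 1) => x y hB [h1 h2 h3 h4]; apply: hB; lia.
exists B.
  by move=> v /hN h; apply: memB; move: (v 0 0) (v 0 1) h => x y [h1 h2 h3 h4]; split; lia.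
split.
  move=> v vc; have : (absz (v 0%R 0%R) + absz (v 0%R 1%R) <= K)%N.
    by rewrite /K (big_rem v vc) leq_addr.
  move: (mem_box (N := (absz N + K + 2)%N) (v := v)); rewrite -/B.
  move: (v 0 0) (v 0 1) => x y hB h; apply: hB; lia.
pose S (v : 'rV[int]_2) := color v * (W (v 0 0) (v 0 1) + W (v 0 0) (v 0 1 - 1)).
have -> : \sum_(v <- B) color v * four_cells W (v 0 0) (v 0 1) =
          \sum_(v <- B) (S v - S (v - pt 1 0)).
  apply: eq_bigr => v _; rewrite /S color_shift !mxE /= subr0 /four_cells.
  move: (color v) (W _ _) (W _ _) (W _ _) (W _ _) => k a1 a2 a3 a4; ring.
rewrite sumrB (sum_translate (F := S)) ?subrr // => v.
rewrite /S mulf_eq0 negb_or => /andP[_ h].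
have : W (v 0 0) (v 0 1) != 0 \/ W (v 0 0) (v 0 1 - 1) != 0.
  have [h0|] := eqVneq (W (v 0 0) (v 0 1)) 0; last by left.
  by right; rewrite h0 add0r in h.
move=> h'; split; apply: memB; rewrite ?mxE /= ?addr0;
  move: h' => [] /hN; move: (v 0 0) (v 0 1) => x y [h1 h2 h3 h4]; split; lia.
Qed.

(** The sum over the lattice of [sum_color_all], split into the vertices on the
    cycle and the others. *)
Lemma sum_turn (V : {fset 'rV[int]_2}) :
  (forall v : 'rV[int]_2, v \notin c -> v \notin V -> W (v 0 0) (v 0 1 - 1) = 0) ->
  4 * (\sum_(v <- V | v \notin c) color v * W (v 0 0) (v 0 1 - 1)) =
  \sum_(v <- c) color v * vturn (prev c v) v (next c v).
Proof.
move=> offV; have [B suppB [cB sB]] := sum_color_all.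
pose h (v : 'rV[int]_2) := if v \notin c then color v * W (v 0 0) (v 0 1 - 1) else 0.
have e1 : \sum_(v <- V | v \notin c) color v * W (v 0 0) (v 0 1 - 1) = \sum_(v <- B) h v.
  have hB v : v \notin B -> h v = 0.
    rewrite /h; case: ifP => // _ vB; apply/eqP; apply: contraNT vB.
    by rewrite mulf_eq0 negb_or => /andP[_]; apply: suppB.
  have hV v : v \notin V -> h v = 0.
    by rewrite /h; case: ifP => // vc vV; rewrite offV ?mulr0.
  by rewrite big_mkcond -[RHS](fsbigTE _ _ hB) [RHS](fsbigTE _ _ hV).
have e2 : \sum_(v <- B | v \in c) color v * four_cells W (v 0 0) (v 0 1) =
          \sum_(v <- c) color v * four_cells W (v 0 0) (v 0 1).
  rewrite -big_filter; apply: perm_big; apply: uniq_perm.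
  - by rewrite filter_uniq ?fset_uniq.
  - exact: traverses_uniq tc.
  - by move=> v; rewrite mem_filter andb_idr //; apply: cB.
rewrite e1 mulr_sumr; apply/eqP; rewrite -subr_eq0 addrC -sum_color_on -e2 -[X in _ == X]sB.
rewrite [X in _ == X](bigID (mem c)) /=; apply/eqP; congr (_ + _).
rewrite [RHS]big_mkcond; apply: eq_bigr => v _; rewrite /h.
case: ifP => vc; last by rewrite mulr0.
have [e1' e2' e3'] := crossings_corners tc lg vc.
by rewrite /four_cells /W e1' e2' e3' -!/(W _ _); ring.
Qed.

End Cycle.

(** * Winding numbers of plane curves *)

Section PlaneCurves.
Variable R : realType.

(** The argument of (a, b) when (a, b) lies in the open half-plane centred on
    the direction of angle alpha. *)
Definition ang (alpha a b : R) : R :=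
  alpha + atan ((- a * sin alpha + b * cos alpha) / (a * cos alpha + b * sin alpha)).

Lemma ang_polar (alpha a b : R) : 0 < a * cos alpha + b * sin alpha ->
  exists2 r, 0 < r & a = r * cos (ang alpha a b) /\ b = r * sin (ang alpha a b).
Proof.
rewrite /ang; set d := a * cos alpha + b * sin alpha.
set k := - a * sin alpha + b * cos alpha => d0; set t := atan (k / d).
have ct : 0 < cos t.
  by apply: cos_gt0_pihalf; rewrite atan_gtNpi2 atan_ltpi2.
have st : sin t = k / d * cos t.
  by have := atanK (k / d); rewrite -/t /tan => <-; rewrite divfK ?gt_eqF.
exists (d / cos t); first by rewrite divr_gt0.
have ct0 : cos t != 0 by rewrite gt_eqF.
have d0' : d != 0 by rewrite gt_eqF.
have e1 : d / cos t * cos t = d by rewrite divfK.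
have e2 : d / cos t * sin t = k by rewrite st; field; rewrite ct0 d0'.
have cs : (cos alpha) ^+ 2 + (sin alpha) ^+ 2 = 1 by exact: cos2Dsin2.
rewrite cosD sinD; split.
  transitivity (d / cos t * cos t * cos alpha - d / cos t * sin t * sin alpha); last by ring.
  rewrite e1 e2 /d /k -[LHS]mulr1 -cs; ring.
transitivity (d / cos t * cos t * sin alpha + d / cos t * sin t * cos alpha); last by ring.
rewrite e1 e2 /d /k -[LHS]mulr1 -cs; ring.
Qed.

Lemma polar_inj (r1 r2 t1 t2 : R) : 0 < r1 -> 0 < r2 ->
  r1 * cos t1 = r2 * cos t2 -> r1 * sin t1 = r2 * sin t2 -> cos (t1 - t2) = 1.
Proof.
move=> r10 r20 hc hs.
have e1 := cos2Dsin2 t1; have e2 := cos2Dsin2 t2.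
have er : r1 = r2.
  apply/eqP; rewrite -(@eqrXn2 _ 2) ?ltW //; apply/eqP.
  have : r1 ^+ 2 * (cos t1 ^+ 2 + sin t1 ^+ 2) = r2 ^+ 2 * (cos t2 ^+ 2 + sin t2 ^+ 2).
    by rewrite !mulrDr -!exprMn hc hs.
  by rewrite e1 e2 !mulr1.
have r0 : r2 != 0 by rewrite gt_eqF.
rewrite er in hc hs; rewrite cosB (mulfI r0 hc) (mulfI r0 hs) -!expr2.
exact: cos2Dsin2.
Qed.

(** Two arguments of one curve differ by a continuous function with cosine 1;
    if its ends were different, it would take a value half a turn away from the
    first one. *)
Lemma winding_number_unique (f : R -> 'rV[R]_2) p n m :
  winding_number f p n -> winding_number f p m -> n = m.
Proof.
move=> [t1 [c1 h1 e1]] [t2 [c2 h2 e2]].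
pose u x := t1 x - t2 x.
have cu : {within `[0, 1], continuous u}.
  by apply: within_continuousB.
have cosu x : 0 <= x <= 1 -> cos (u x) = 1.
  move=> hx; have [r1 r10 [a1 b1]] := h1 _ hx; have [r2 r20 [a2 b2]] := h2 _ hx.
  by apply: (polar_inj r10 r20); rewrite -?a1 -?a2 -?b1 -?b2.
have eu : u 1 - u 0 = 2 * pi * (n - m)%:~R.
  by rewrite rmorphB /= mulrBr -e1 -e2 /u; ring.
have pi0 := pi_gt0 R.
have [//|nm] := eqVneq n m; exfalso.
suff [x hx ux] : exists2 x, x \in `[0, 1] & (u x = u 0 + pi \/ u x = u 0 - pi).
  have := cosu x hx; have := cosu 0; rewrite lexx ler01 => /(_ isT) c0.
  case: ux => ->; first by rewrite cosDpi c0; lra.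
  by rewrite cosB cospi sinpi c0; lra.
have /orP h : (2 * pi <= u 1 - u 0) || (u 1 - u 0 <= - (2 * pi)).
  have : (1 <= n - m) || (n - m <= -1) by move/eqP: nm; lia.
  case/orP => h; rewrite eu; apply/orP; [left|right]; rewrite -(ler_int R) in h.
    by rewrite ler_peMr // mulr_ge0 // ltW.
  rewrite rmorphN1 in h; rewrite -[X in _ <= X]mulrN1; apply: ler_wpM2l => //.
  by rewrite mulr_ge0 // ltW.
case: h => h.
  have [|x hx ux] := @IVT R u 0 1 (u 0 + pi) ler01 cu.
    by rewrite ge_min le_max; apply/andP; split; apply/orP; [left|right]; lra.
  by exists x => //; left.
have [|x hx ux] := @IVT R u 0 1 (u 0 - pi) ler01 cu.
  by rewrite ge_min le_max; apply/andP; split; apply/orP; [right|left]; lra.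
by exists x => //; right.
Qed.

Lemma continuous_pair (T U V : topologicalType) (f : T -> U) (g : T -> V) :
  continuous f -> continuous g -> continuous (fun x => (f x, g x)).
Proof.
move=> cf cg x.
exact: (@cvg_pair _ _ _ (nbhs x) (nbhs (f x)) (nbhs (g x)) _ _ _ f g (cf x) (cg x)).
Qed.

(** The retraction of the line onto the unit interval; composing with it turns
    continuity within [0, 1] into continuity. *)
Definition clamp (x : R) : R := Num.max 0 (Num.min 1 x).

Lemma clamp_ge0 x : 0 <= clamp x.
Proof. by rewrite /clamp le_max lexx. Qed.
Lemma clamp_le1 x : clamp x <= 1.
Proof. by rewrite /clamp ge_max ler01 ge_min lexx. Qed.
Lemma clamp_id x : 0 <= x <= 1 -> clamp x = x.
Proof. by move=> /andP[x0 x1]; rewrite /clamp (min_idPr x1) (max_idPr x0). Qed.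
Lemma clamp_ge1 x : 1 <= x -> clamp x = 1.
Proof. by move=> x1; rewrite /clamp (min_idPl x1) (max_idPr ler01). Qed.
Lemma clamp_le0 x : x <= 0 -> clamp x = 0.
Proof.
by move=> x0; rewrite /clamp (min_idPr (le_trans x0 ler01)) (max_idPl x0).
Qed.
Lemma clamp01 x : 0 <= clamp x <= 1.
Proof. by rewrite clamp_ge0 clamp_le1. Qed.

Lemma continuous_clamp : continuous clamp.
Proof.
move=> x; apply: (@continuous_max R R (fun=> 0) (fun y => Num.min 1 y)).
  exact: cvg_cst.
by apply: (@continuous_min R R (fun=> 1) id); [exact: cvg_cst|exact: cvg_id].
Qed.

Lemma within_comp (T U W : topologicalType) (A : set U) (g : T -> U) (f : U -> W) :
  continuous g -> (forall x, A (g x)) -> {within A, continuous f} -> continuous (f \o g).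
Proof.
move=> cg gA cf x.
move=> B hB; have := cf (g x) B hB.
rewrite /nbhs /= -(nbhs_subspace_in (gA x)) => h.
have := cg x _ h; rewrite /nbhs /=; apply: filterS => y; apply; exact: gA.
Qed.

Lemma winding_number_eq (f g : R -> 'rV[R]_2) p q n :
  (forall x, 0 <= x <= 1 -> f x - p = g x - q) ->
  winding_number f p n -> winding_number g q n.
Proof.
move=> fg [t [ct ht et]]; exists t; split=> // x hx.
have [r r0 h] := ht x hx; exists r => //.
by move/rowP: (fg x hx) => e; have := (e 0, e 1); rewrite !mxE => -[<- <-].
Qed.

Definition dot (a b : 'rV[R]_2) : R := a 0 0 * b 0 0 + a 0 1 * b 0 1.

Lemma dotC a b : dot a b = dot b a.
Proof. by rewrite /dot ![b 0 _ * _]mulrC. Qed.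

(** If f - p and g - p always make an acute angle, that angle is a continuous
    function with the same value at both ends, and adding it to an argument of
    f - p gives an argument of g - p. *)
Lemma winding_number_dot (f g : R -> 'rV[R]_2) p n :
  continuous f -> continuous g -> f 0 = f 1 -> g 0 = g 1 ->
  (forall x, 0 <= x <= 1 -> 0 < dot (f x - p) (g x - p)) ->
  winding_number f p n -> winding_number g p n.
Proof.
move=> cf cg f01 g01 fg [t [ct ht et]].
pose a x := f x - p; pose b x := g x - p.
pose k x := a x 0 0 * b x 0 1 - a x 0 1 * b x 0 0.
pose s x := atan (k x / dot (a x) (b x)).
have ca i : continuous (fun x => a x 0 i).
  move=> x; apply: (@continuous_comp _ _ _ a
    (fun M : 'rV[R]_2 => M 0 i)); last exact: coord_continuous.
  by apply: cvgB; [exact: cf|exact: cvg_cst].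
have cb i : continuous (fun x => b x 0 i).
  move=> x; apply: (@continuous_comp _ _ _ b
    (fun M : 'rV[R]_2 => M 0 i)); last exact: coord_continuous.
  by apply: cvgB; [exact: cg|exact: cvg_cst].
have cs : {within `[0, 1], continuous s}.
  apply: continuous_in_subspaceT => x; rewrite inE /= in_itv /= => hx.
  apply: (@continuous_comp _ _ _ (fun x => k x / dot (a x) (b x)) atan); last exact: continuous_atan.
  apply: cvgM; first by apply: cvgB; apply: cvgM; [exact: ca|exact: cb|exact: ca|exact: cb].
  apply: cvgV; first by rewrite gt_eqF // fg.
  by apply: cvgD; apply: cvgM; [exact: ca|exact: cb|exact: ca|exact: cb].
exists (fun x => t x + s x); split.
- by apply: within_continuousD.
- move=> x hx; have [r r0 [h1 h2]] := ht x hx.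
  have e1 : a x 0 0 = r * cos (t x) by rewrite /a !mxE.
  have e2 : a x 0 1 = r * sin (t x) by rewrite /a !mxE.
  have d0 := fg x hx.
  have rn : r != 0 by rewrite gt_eqF.
  have ed : dot (a x) (b x) = r * (b x 0 0 * cos (t x) + b x 0 1 * sin (t x)).
    by rewrite /dot e1 e2; ring.
  have ek : k x = r * (- b x 0 0 * sin (t x) + b x 0 1 * cos (t x)).
    by rewrite /k e1 e2; ring.
  have d1 : 0 < b x 0 0 * cos (t x) + b x 0 1 * sin (t x).
    by move: d0; rewrite -/(a x) -/(b x) ed pmulr_rgt0.
  have [r' r'0] := ang_polar d1; rewrite /ang.
  have -> : (- b x 0 0 * sin (t x) + b x 0 1 * cos (t x))
      / (b x 0 0 * cos (t x) + b x 0 1 * sin (t x)) = k x / dot (a x) (b x).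
    by rewrite ed ek -mulf_div divff // mul1r.
  by move=> [h3 h4]; exists r' => //; rewrite -h3 -h4 /b !mxE.
- by rewrite -et /s /k /a /b f01 g01; ring.
Qed.

Lemma winding_number_const (f : R -> 'rV[R]_2) p n :
  (forall x, f x = f 0) -> winding_number f p n -> n = 0.
Proof.
move=> fc h; apply: (winding_number_unique h); have [t [ct ht et]] := h.
exists (fun=> t 0); split.
- by apply: continuous_subspaceT => x; exact: cvg_cst.
- by move=> x hx; rewrite fc; apply: ht; rewrite lexx ler01.
- by rewrite subrr mulr0.
Qed.

(** By compactness of [0, 1], nearby stages of the homotopy satisfy the
    hypothesis of [winding_number_dot]; so the stages with winding number n form
    an open and closed set of parameters, and [0, 1] is connected. *)
Lemma winding_number_homotopy (H : R * R -> 'rV[R]_2) p n :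
  continuous H -> (forall z, H z != p) -> (forall s, H (s, 0) = H (s, 1)) ->
  winding_number (fun x => H (0, x)) p n -> winding_number (fun x => H (1, x)) p n.
Proof.
move=> cH Hp loop h0.
have cs s : continuous (fun x => H (s, x)).
  move=> x; apply: (@continuous_comp _ _ _ (fun x => (s, x)) H); last exact: cH.
  by apply: continuous_pair => y; [exact: cvg_cst|exact: cvg_id].
pose E : set R := [set s | winding_number (fun x => H (s, x)) p n].
have near_dot s0 : \forall s \near s0, `[0, 1] `<=` [set x | 0 < dot (H (s0, x) - p) (H (s, x) - p)].
  have := @segment_compact R 0 1; rewrite compact_near_coveringP => cpt.
  apply: (cpt R (nbhs s0) (fun s x => 0 < dot (H (s0, x) - p) (H (s, x) - p))) => x hx.
  pose K (z : R * R) := dot (H (s0, z.1) - p) (H (z.2, z.1) - p).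
  have cK : {for (x, s0), continuous K}.
    have c1 i : continuous (fun z : R * R => (H (s0, z.1) - p) 0 i).
      move=> z; apply: (@continuous_comp _ _ _ (fun z : R * R => H (s0, z.1) - p)
        (fun M : 'rV[R]_2 => M 0 i)); last exact: coord_continuous.
      apply: cvgB; last exact: cvg_cst.
      apply: (@continuous_comp _ _ _ (fun z : R * R => z.1) (fun x => H (s0, x))); last exact: cs.
      exact: cvg_fst.
    have c2 i : continuous (fun z : R * R => (H (z.2, z.1) - p) 0 i).
      move=> z; apply: (@continuous_comp _ _ _ (fun z : R * R => H (z.2, z.1) - p)
        (fun M : 'rV[R]_2 => M 0 i)); last exact: coord_continuous.
      apply: cvgB; last exact: cvg_cst.
      apply: (@continuous_comp _ _ _ (fun z : R * R => (z.2, z.1)) H); last exact: cH.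
      by apply: continuous_pair => y; [exact: cvg_snd|exact: cvg_fst].
    by apply: cvgD; apply: cvgM; [exact: c1|exact: c2|exact: c1|exact: c2].
  have K0 : 0 < K (x, s0).
    rewrite /K /= /dot -!expr2 lt_neqAle addr_ge0 ?sqr_ge0 // andbT eq_sym.
    rewrite paddr_eq0 ?sqr_ge0 // !sqrf_eq0; apply/negP => /andP[/eqP e0 /eqP e1].
    move/eqP: (Hp (s0, x)); apply; apply/eqP; rewrite -subr_eq0; apply/eqP/rowP => i.
    rewrite [RHS]mxE; have [->|->] := ord2P i.
      exact: e0.
    exact: e1.
  have := cK _ (open_nbhs_nbhs (conj (@open_gt R 0) K0)).
  by [].
have locE s0 : \forall s \near s0, E s <-> E s0.
  near=> s.
  have hs : `[0, 1] `<=` [set x | 0 < dot (H (s0, x) - p) (H (s, x) - p)] by near: s; exact: near_dot.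
  split; [apply: (winding_number_dot (cs s) (cs s0) (loop s) (loop s0)) => x hx
         |apply: (winding_number_dot (cs s0) (cs s) (loop s0) (loop s)) => x hx].
    by rewrite dotC; apply: hs; rewrite /= in_itv.
  by apply: hs; rewrite /= in_itv.
have oE : open E.
  rewrite openE => s0 Es0; rewrite /interior; near=> s.
  have [_] : E s <-> E s0 by near: s; exact: locE.
  exact.
have clE : closed E.
  rewrite -openC openE => s0 Es0; rewrite /interior; near=> s.
  have [h _] : E s <-> E s0 by near: s; exact: locE.
  by move=> /h.
have EE : (`[0, 1]%classic : set R) `&` E = `[0, 1]%classic.
  apply: (@segment_connected R 0 1); [|by exists E|by exists E].
  by exists 0; split=> //; rewrite /= in_itv /= lexx ler01.
have : (`[0, 1]%classic : set R) 1 by rewrite /= in_itv /= lexx ler01.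
by rewrite -EE => -[].
Unshelve. all: by end_near.
Qed.

End PlaneCurves.

(** * Winding numbers of lattice polygons *)

Section Glue.
Variables (R : realType) (V : zmodType) (G : nat -> R -> V).

(** The sum of the increments of the successive pieces of a curve is continuous
    term by term, while the right-hand side follows, up to the starting point,
    the curve given by G k on [k, k + 1]. *)
Lemma glue_sum (m : nat) (y : R) : (forall k, (k < m)%N -> G k 1 = G k.+1 0) ->
  0 <= y <= m%:R ->
  \sum_(k < m) (G k (clamp (y - k%:R)) - G k 0) =
  G (Num.truncn y) (y - (Num.truncn y)%:R) - G 0 0.
Proof.
elim: m => [|m IH] chain /andP[y0 ym].
  have -> : y = 0 by apply/eqP; rewrite eq_le ym y0.
  by rewrite big_ord0 truncn0 subr0 subrr.
have chain' k : (k < m)%N -> G k 1 = G k.+1 0 by move=> h; apply: chain; apply: ltnW.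
rewrite big_ord_recr /=; have [yle|ygt] := leP y m%:R.
  by rewrite IH ?y0 // clamp_le0 ?subr_le0 // subrr addr0.
have -> : \sum_(k < m) (G k (clamp (y - k%:R)) - G k 0) = G m 0 - G 0%N 0.
  rewrite -(big_mkord xpredT (fun k => G k (clamp (y - k%:R)) - G k 0)).
  apply: (@telescope_sumr_eq V 0 m (fun k => G k 0)) => // k /andP[_ km].
  rewrite clamp_ge1 ?chain' //.
  by rewrite lerBrDr addrC natr1 (le_trans _ (ltW ygt)) // ler_nat.
have [ylt|] := ltP y m.+1%:R.
  have -> : Num.truncn y = m by apply/eqP; rewrite truncn_eq // ltW.
  rewrite clamp_id; last by rewrite subr_ge0 (ltW ygt) lerBlDr addrC natr1.
  by rewrite addrC addrA subrK.
move=> h; have -> : y = m.+1%:R by apply/eqP; rewrite eq_le ym h.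
rewrite natrK subrr -chain // clamp_ge1; last by rewrite lerBrDr nat1r.
by rewrite addrC addrA subrK.
Qed.

End Glue.

Section LatticeArgument.
Variable R : realType.

Lemma cos_eq1 (d : R) : - (2 * pi) < d < 2 * pi -> cos d = 1 -> d = 0.
Proof.
wlog d0 : d / 0 <= d => [hw|].
  have [/hw//|d0] := leP 0 d; move=> /andP[h1 h2] cd.
  have := hw (- d); rewrite cosN oppr_ge0 (ltW d0) => /(_ isT) h.
  by apply/eqP; rewrite -oppr_eq0 h //; apply/andP; split; lra.
move=> /andP[_ d2]; rewrite {1}(splitr d) cosD => h.
have := cos2Dsin2 (d / 2) => h'.
rewrite -!expr2 in h; have s0 : sin (d / 2) = 0 by apply/eqP; rewrite -sqrf_eq0; apply/eqP; lra.
move: d0; rewrite le_eqVlt => /orP[/eqP //|dpos].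
have : 0 < sin (d / 2) by apply: sin_gt0_pi; apply/andP; split; lra.
by rewrite s0 ltxx.
Qed.

(** Both angles are arguments of (a, b), and they differ by less than a full
    turn. *)
Lemma ang_eq (alpha beta a b : R) : - pi <= alpha - beta <= pi ->
  0 < a * cos alpha + b * sin alpha -> 0 < a * cos beta + b * sin beta ->
  ang alpha a b = ang beta a b.
Proof.
move=> /andP[h1 h2] ha hb.
have [r r0 [e1 e2]] := ang_polar ha; have [r' r'0 [e1' e2']] := ang_polar hb.
apply/eqP; rewrite -subr_eq0; apply/eqP/cos_eq1.
  rewrite /ang; set x := atan _; set y := atan _.
  have := atan_gtNpi2 ((- a * sin alpha + b * cos alpha) / (a * cos alpha + b * sin alpha)).
  have := atan_ltpi2 ((- a * sin alpha + b * cos alpha) / (a * cos alpha + b * sin alpha)).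
  have := atan_gtNpi2 ((- a * sin beta + b * cos beta) / (a * cos beta + b * sin beta)).
  have := atan_ltpi2 ((- a * sin beta + b * cos beta) / (a * cos beta + b * sin beta)).
  rewrite -/x -/y => *; apply/andP; split; lra.
by apply: (polar_inj r0 r'0); rewrite -?e1 -?e2.
Qed.

Lemma cosNpihalf : cos (- (pi / 2)) = 0 :> R. Proof. by rewrite cosN cos_pihalf. Qed.
Lemma sinNpihalf : sin (- (pi / 2)) = -1 :> R. Proof. by rewrite sinN sin_pihalf. Qed.

(** The argument in [0, 2 pi), given by the half-planes centred on the four
    axis directions; its cut is the positive horizontal axis. *)
Definition lattice_arg (a b : int) : R :=
  if (0 < a) && (0 <= b) then ang 0 a%:~R b%:~R
  else if 0 < b then ang (pi / 2) a%:~R b%:~R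
  else if a < 0 then ang pi a%:~R b%:~R
  else ang (- (pi / 2)) a%:~R b%:~R + 2 * pi.

Definition half0 := (@cos0 R, @sin0 R).
Definition half1 := (@cos_pihalf R, @sin_pihalf R).
Definition half2 := (@cospi R, @sinpi R).
Definition half3 := (cosNpihalf, sinNpihalf).

Lemma lattice_arg_right a b : 0 < a ->
  ang 0 a%:~R b%:~R = lattice_arg a b - 2 * pi * (ind (b < 0))%:~R.
Proof.
move=> a0; rewrite /lattice_arg a0 /=; have [b0|b0] := leP 0 b.
  by rewrite /ind mulr0 subr0.
rewrite (lt_gtF b0) (lt_gtF a0) /ind mulr1 addrK.
have pi0 := pi_gt0 R; apply: ang_eq; first by apply/andP; split; lra.
  by rewrite !half0 mulr1 mulr0 addr0 ltr0z.
by rewrite !half3 mulr0 add0r mulrN1 oppr_gt0 ltrz0.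
Qed.

Lemma lattice_arg_up a b : 0 < b -> ang (pi / 2) a%:~R b%:~R = lattice_arg a b.
Proof.
move=> b0; rewrite /lattice_arg b0 (ltW b0) andbT; case: ifP => // a0.
have pi0 := pi_gt0 R; apply: ang_eq; first by apply/andP; split; lra.
  by rewrite !half1 mulr1 mulr0 add0r ltr0z.
by rewrite !half0 mulr1 mulr0 addr0 ltr0z.
Qed.

Lemma lattice_arg_left a b : a < 0 -> ang pi a%:~R b%:~R = lattice_arg a b.
Proof.
move=> a0; rewrite /lattice_arg a0 (lt_gtF a0) /=; case: ifP => // b0.
have pi0 := pi_gt0 R; apply: ang_eq; first by apply/andP; split; lra.
  by rewrite !half2 mulr0 addr0 mulrN1 oppr_gt0 ltrz0.
by rewrite !half1 mulr1 mulr0 add0r ltr0z.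
Qed.

Lemma lattice_arg_down a b : b < 0 ->
  ang (- (pi / 2)) a%:~R b%:~R + 2 * pi = lattice_arg a b.
Proof.
move=> b0; rewrite /lattice_arg (lt_gtF b0) leNgt b0 andbF; case: ifP => // a0.
have pi0 := pi_gt0 R.
have -> : ang (- (pi / 2)) a%:~R b%:~R + 2 * pi =
    ang (- (pi / 2) + pi *+ 2) a%:~R b%:~R :> R.
  by rewrite /ang sinD2pi cosD2pi mulr_natl addrAC.
apply: ang_eq; first by apply/andP; split; rewrite (mulr2n pi); lra.
  by rewrite sinD2pi cosD2pi !half3 mulr0 add0r mulrN1 oppr_gt0 ltrz0.
by rewrite !half2 mulr0 addr0 mulrN1 oppr_gt0 ltrz0.
Qed.

Definition seg (r : R) (a1 a2 : int) : R := (1 - r) * a1%:~R + r * a2%:~R.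

Lemma seg_half (alpha : R) (a1 b1 a2 b2 : int) (r : R) : 0 <= r <= 1 ->
  0 < a1%:~R * cos alpha + b1%:~R * sin alpha ->
  0 < a2%:~R * cos alpha + b2%:~R * sin alpha ->
  0 < seg r a1 a2 * cos alpha + seg r b1 b2 * sin alpha.
Proof.
move=> /andP[r0 r1] h1 h2; rewrite /seg.
have -> : ((1 - r) * a1%:~R + r * a2%:~R) * cos alpha + ((1 - r) * b1%:~R + r * b2%:~R) * sin alpha =
  (1 - r) * (a1%:~R * cos alpha + b1%:~R * sin alpha) + r * (a2%:~R * cos alpha + b2%:~R * sin alpha) by ring.
have [->|rn] := eqVneq r 0; first by rewrite subr0 mul1r mul0r addr0.
by rewrite ltr_wpDl // ?mulr_ge0 ?subr_ge0 ?(ltW h1) // mulr_gt0 // lt_neqAle eq_sym rn.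
Qed.

Lemma seg_lift (alpha : R) (a1 b1 a2 b2 : int) :
    0 < a1%:~R * cos alpha + b1%:~R * sin alpha ->
    0 < a2%:~R * cos alpha + b2%:~R * sin alpha ->
  let tau r := ang alpha (seg r a1 a2) (seg r b1 b2) in
  continuous (tau \o @clamp R) /\
  forall r, 0 <= r <= 1 -> exists2 rho, 0 < rho &
    seg r a1 a2 = rho * cos (tau r) /\ seg r b1 b2 = rho * sin (tau r).
Proof.
move=> h1 h2 tau; split; last by move=> r hr; apply: ang_polar; apply: seg_half.
have cseg (u v : int) : continuous (fun x => seg (clamp x) u v).
  move=> x; apply: cvgD; apply: cvgM; try exact: cvg_cst; last exact: continuous_clamp.
  by apply: cvgB; [exact: cvg_cst|exact: continuous_clamp].
move=> x; apply: cvgD; first exact: cvg_cst.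
apply: (@continuous_comp _ _ _ (fun x =>
  (- seg (clamp x) a1 a2 * sin alpha + seg (clamp x) b1 b2 * cos alpha)
  / (seg (clamp x) a1 a2 * cos alpha + seg (clamp x) b1 b2 * sin alpha)) (@atan R));
  last exact: continuous_atan.
apply: cvgM.
  apply: cvgD; apply: cvgM; try exact: cvg_cst; last exact: cseg.
  by apply: cvgN; exact: cseg.
apply: cvgV; first by rewrite gt_eqF // seg_half // clamp01.
by apply: cvgD; apply: cvgM; try exact: cvg_cst; exact: cseg.
Qed.

Lemma periodic_int (f : R -> R) (k : int) t : periodic f (pi *+ 2) ->
  f (t + 2 * pi * k%:~R) = f t.
Proof.
move=> per; have e n : 2 * pi * (Posz n)%:~R = (pi *+ 2) *+ n :> R.
  by rewrite -pmulrn mulr_natr [2 * pi]mulr_natl.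
case: k => n; first by rewrite e periodicn.
by rewrite NegzE mulrNz mulrN e -(periodicn per n.+1) subrK.
Qed.

(** A unit segment of the lattice that avoids the origin lies in one of the four
    half-planes. The argument follows [lattice_arg], except across its cut, which
    is crossed by the vertical steps between the rows -1 and 0 to the right of
    the origin: the steps counted by the ray from the cell (0, -1). *)
Lemma segment_lift (a1 b1 a2 b2 : int) : lattice_step a1 b1 a2 b2 ->
  ~ (a1 = 0 /\ b1 = 0) -> ~ (a2 = 0 /\ b2 = 0) ->
  exists tau : R -> R, [/\ continuous (tau \o @clamp R),
    forall r, 0 <= r <= 1 -> exists2 rho, 0 < rho &
      seg r a1 a2 = rho * cos (tau r) /\ seg r b1 b2 = rho * sin (tau r),
    tau 0 = lattice_arg a1 b1 &
    tau 1 = lattice_arg a2 b2 + 2 * pi * (step_crossing 0 (-1) a1 b1 a2 b2)%:~R].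
Proof.
move=> st n1 n2.
have seg0 u v : seg 0 u v = u%:~R by rewrite /seg subr0 mul1r mul0r addr0.
have seg1 u v : seg 1 u v = v%:~R by rewrite /seg subrr mul1r mul0r add0r.
have : [\/ 0 < a1 /\ 0 < a2, 0 < b1 /\ 0 < b2, a1 < 0 /\ a2 < 0 | b1 < 0 /\ b2 < 0].
  have : 0 < a1 /\ 0 < a2 \/ 0 < b1 /\ 0 < b2 \/ a1 < 0 /\ a2 < 0 \/ b1 < 0 /\ b2 < 0.
    by case: st => -[h1 h2]; subst a2 b2; lia.
  by case=> [h|[h|[h|h]]]; [apply: Or41|apply: Or42|apply: Or43|apply: Or44].
have lift (alpha : R) (k : int) :
    0 < a1%:~R * cos alpha + b1%:~R * sin alpha ->
    0 < a2%:~R * cos alpha + b2%:~R * sin alpha ->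
    ang alpha a1%:~R b1%:~R + 2 * pi * k%:~R = lattice_arg a1 b1 ->
    ang alpha a2%:~R b2%:~R + 2 * pi * k%:~R =
      lattice_arg a2 b2 + 2 * pi * (step_crossing 0 (-1) a1 b1 a2 b2)%:~R ->
  exists tau : R -> R, [/\ continuous (tau \o @clamp R),
    forall r, 0 <= r <= 1 -> exists2 rho, 0 < rho &
      seg r a1 a2 = rho * cos (tau r) /\ seg r b1 b2 = rho * sin (tau r),
    tau 0 = lattice_arg a1 b1 &
    tau 1 = lattice_arg a2 b2 + 2 * pi * (step_crossing 0 (-1) a1 b1 a2 b2)%:~R].
  move=> p1 p2 e1 e2; have [c pl] := seg_lift p1 p2.
  exists (fun r => ang alpha (seg r a1 a2) (seg r b1 b2) + 2 * pi * k%:~R); split.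
  - by move=> x; apply: cvgD; [exact: c|exact: cvg_cst].
  - by move=> r /pl[rho rho0 [e3 e4]]; exists rho;
      rewrite // (periodic_int _ _ (@cosD2pi R)) (periodic_int _ _ (@sinD2pi R)).
  - by rewrite !seg0.
  - by rewrite !seg1.
case=> -[h1 h2].
- apply: (lift 0 (ind (b1 < 0))); rewrite ?half0 ?mulr1 ?mulr0 ?addr0 ?ltr0z //.
    by rewrite lattice_arg_right // subrK.
  rewrite lattice_arg_right // -addrA; congr (_ + _).
  have -> : step_crossing 0 (-1) a1 b1 a2 b2 = ind (b1 < 0) - ind (b2 < 0).
    by clear lift; case: st => -[h3 h4]; subst a2 b2; ind_lia.
  by rewrite rmorphB /=; ring.
- have c0 : step_crossing 0 (-1) a1 b1 a2 b2 = 0.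
    by clear lift; case: st => -[h3 h4]; subst a2 b2; ind_lia.
  by apply: (lift (pi / 2) 0); rewrite ?c0 ?half1 ?mulr1 ?mulr0 ?addr0 ?add0r ?ltr0z ?lattice_arg_up.
- have c0 : step_crossing 0 (-1) a1 b1 a2 b2 = 0.
    by clear lift; case: st => -[h3 h4]; subst a2 b2; ind_lia.
  by apply: (lift pi 0); rewrite ?c0 ?half2 ?mulr0 ?addr0 ?mulrN1 ?oppr_gt0 ?ltrz0 ?lattice_arg_left.
- have c0 : step_crossing 0 (-1) a1 b1 a2 b2 = 0.
    by clear lift; case: st => -[h3 h4]; subst a2 b2; ind_lia.
  by apply: (lift (- (pi / 2)) 1);
     rewrite ?c0 ?half3 ?mulr0 ?add0r ?mulrN1 ?oppr_gt0 ?ltrz0 ?addr0 ?mulr1 ?lattice_arg_down.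
Qed.
End LatticeArgument.

Section Glue.
Variables (R : realType) (V : normedModType R) (G : nat -> R -> V) (m : nat).
Hypothesis chain : forall k, (k < m)%N -> G k 1 = G k.+1 0.
Hypothesis cG : forall k, continuous (G k \o @clamp R).

Definition glue (x : R) : V :=
  G 0%N 0 + \sum_(k < m) (G k (clamp (x * m%:R - k%:R)) - G k 0).

Lemma glueE x : 0 <= x <= 1 ->
  glue x = G (Num.truncn (x * m%:R)) (x * m%:R - (Num.truncn (x * m%:R))%:R).
Proof.
move=> /andP[x0 x1]; rewrite /glue glue_sum //; first by rewrite addrC subrK.
by rewrite mulr_ge0 //= -[X in _ <= X]mul1r ler_wpM2r.
Qed.

Lemma continuous_glue : continuous glue.
Proof.
have h (k : nat) : continuous (fun y : R => G k (clamp (y * m%:R - k%:R))).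
  move=> y; apply: (@continuous_comp R R V (fun x => x * m%:R - k%:R) (G k \o @clamp R)); last exact: cG.
  by apply: cvgB; [apply: cvgM; [exact: cvg_id|exact: cvg_cst]|exact: cvg_cst].
move=> x; apply: cvgD; first exact: cvg_cst.
apply: (@cvg_big _ _ +%R 0) => [|k _].
  exact: add_continuous.
by apply: cvgB; [exact: h|exact: cvg_cst].
Qed.

End Glue.

Section Polygon.
Variables (R : realType) (c : seq 'rV[int]_2) (g : digraph).
Hypotheses (tc : traverses c g) (lg : lattice_graph g).

Let m := size c.
Let x k := nth 0 c (k %% m).

Let m0 : (0 < m)%N. Proof. by case: tc; rewrite /m; case: (c). Qed.

Let xc k : x k \in c. Proof. by rewrite mem_nth // ltn_mod. Qed.

Let next_x k : next c (x k) = x k.+1.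
Proof.
have [_ uc _] := tc.
rewrite next_nth xc /x index_uniq ?ltn_mod // -/m.
have -> : (k.+1 %% m = (k %% m).+1 %% m)%N by rewrite -addn1 -modnDml addn1.
have : (k %% m < m)%N by rewrite ltn_mod.
move: (k %% m)%N => i; rewrite /m; case: (c) => [|y p] //= ip.
move: ip; rewrite ltnS leq_eqVlt => /orP[/eqP ->|ip].
  by rewrite modnn nth_default.
by rewrite modn_small ?ltnS //=; apply: set_nth_default.
Qed.

Let pG k (r : R) : 'rV[R]_2 := (1 - r) *: embed R (x k) + r *: embed R (x k.+1).

Let pchain k : (k < m)%N -> pG k 1 = pG k.+1 0.
Proof. by rewrite /pG subrr subr0 !scale0r !scale1r add0r addr0. Qed.

Let pcont k : continuous (pG k \o @clamp R).
Proof.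
move=> r; apply: cvgD; apply: cvgZ; try exact: cvg_cst; last exact: continuous_clamp.
by apply: cvgB; [exact: cvg_cst|exact: continuous_clamp].
Qed.

Lemma polygonE t : 0 <= t <= 1 -> @polygon R c t = glue pG m t.
Proof. by move=> ht; rewrite (glueE pchain ht). Qed.

Lemma polygon_continuous : {within `[0, 1], continuous (@polygon R c)}.
Proof.
apply: (@subspace_eq_continuous _ _ _ (glue pG m)).
  by move=> t; rewrite inE /= in_itv /= => ht; exact/esym/polygonE.
by apply: continuous_subspaceT; apply: continuous_glue.
Qed.

Lemma polygon_closed : @polygon R c 0 = @polygon R c 1.
Proof.
rewrite /polygon mul0r mul1r truncn0 natrK !subrr !subr0 !scale0r !scale1r !addr0.
by rewrite modnn mod0n.
Qed.

Let xg k : (x k, x k.+1) \in g.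
Proof. by rewrite (mem_out tc) ?next_x. Qed.

Lemma polygon_seg (t : R) : 0 <= t <= 1 ->
  exists (u w : 'rV[int]_2) (r : R), [/\ 0 <= r <= 1,
  u \in c, w \in c, Defs.adjacent u w &
  polygon c t = (1 - r) *: embed R u + r *: embed R w].
Proof.
move=> /andP[t0 t1]; set k := Num.truncn (t * m%:R).
have tm : 0 <= t * m%:R by rewrite mulr_ge0.
exists (x k), (x k.+1), (t * m%:R - k%:R); split=> //; last exact: (lg (xg k)).
have := truncn_itv tm; rewrite -/k => /andP[h1 h2].
by rewrite subr_ge0 h1 lerBlDr addrC natr1 ltW.
Qed.

(** The lifts of the successive edges are glued after adding the full turns
    accumulated so far. *)
Lemma polygon_winding (v : 'rV[int]_2) : v \notin c ->
  winding_number (@polygon R c) (embed R v) (crossings 0 1 (v 0 0) (v 0 1 - 1) g).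
Proof.
move=> vc.
pose a k := x k 0 0 - v 0 0; pose b k := x k 0 1 - v 0 1.
have ab k : ~ (a k = 0 /\ b k = 0).
  move=> [/eqP ak /eqP bk]; rewrite !subr_eq0 in ak bk.
  have xv : x k = v by apply: rV2P; apply/eqP.
  by move: (xc k); rewrite xv (negbTE vc).
have st k : lattice_step (a k) (b k) (a k.+1) (b k.+1).
  have := @adjacent_step _ _ 0 1 isT (lg (xg k)); rewrite /a /b /=.
  by move: (x k 0 0) (x k 0 1) (x k.+1 0 0) (x k.+1 0 1) => ? ? ? ? [|||] [-> ->];
    [apply: Or41|apply: Or42|apply: Or43|apply: Or44]; split; rewrite // addrAC.
have [tau htau] := choice (fun k => @segment_lift R _ _ _ _ (st k) (ab k) (ab k.+1)).
pose cr k := step_crossing 0 (-1) (a k) (b k) (a k.+1) (b k.+1).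
pose Th k (r : R) := tau k r + 2 * pi * (\sum_(l < k) cr l)%:~R.
have chain k : (k < m)%N -> Th k 1 = Th k.+1 0.
  move=> _; have [_ _ _ e] := htau k; have [_ _ e' _] := htau k.+1.
  rewrite /Th e e' big_ord_recr /= [in RHS]intrD [in RHS]mulrDr -[LHS]addrA.
  by congr (_ + _); exact: addrC.
have cont k : continuous (Th k \o @clamp R).
  by move=> r; apply: cvgD; [have [h _ _ _] := htau k; exact: h|exact: cvg_cst].
exists (glue Th m); split.
- by apply: continuous_subspaceT; apply: continuous_glue.
- move=> t ht; rewrite (glueE chain ht) polygonE // (glueE pchain ht).
  set k := Num.truncn _; set r := t * _ - _.
  have hr : 0 <= r <= 1.
    have /andP[t0 _] := ht; have tm : 0 <= t * m%:R by rewrite mulr_ge0.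
    have := truncn_itv tm; rewrite -/k => /andP[h1 h2].
    by rewrite /r subr_ge0 h1 lerBlDr addrC natr1 ltW.
  have [_ /(_ r hr)[rho rho0 [e1 e2]] _ _] := htau k.
  exists rho => //; rewrite (periodic_int _ _ (@cosD2pi R)) (periodic_int _ _ (@sinD2pi R)) -e1 -e2.
  by rewrite /pG !mxE /seg /a /b !intrB; split; ring.
- rewrite !glueE // ?lexx ?ler01 // mul1r mul0r truncn0 natrK !subrr.
  have [_ _ e _] := htau m; have [_ _ e' _] := htau 0%N.
  rewrite /Th e e' big_ord0 mulr0 addr0.
  have -> : a m = a 0%N by rewrite /a /x modnn mod0n.
  have -> : b m = b 0%N by rewrite /b /x modnn mod0n.
  rewrite addrAC subrr add0r; congr (_ * _%:~R).
  rewrite /crossings (traverses_sum _ tc) (big_nth 0) big_mkord.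
  apply: eq_bigr => l _; have -> : nth 0 c l = x l by rewrite /x modn_small.
  rewrite next_x /cr /crossing /step_crossing /a /b /=.
  by congr (ind _ - ind _);
    move: (x l 0 0) (x l 0 1) (x l.+1 0 0) (x l.+1 0 1) (v 0 0) (v 0 1) => *; lia.
Qed.

End Polygon.

Lemma wind_crossings (R : realType) (c : seq 'rV[int]_2) g v :
  traverses c g -> lattice_graph g -> v \notin c ->
  wind R g v = crossings 0 1 (v 0 0) (v 0 1 - 1) g.
Proof.
move=> tc lg vc; rewrite /wind; set P := [set n | _].
have : P (xget 0 P).
  by apply: (@xgetI _ _ _ (crossings 0 1 (v 0 0) (v 0 1 - 1) g)); exists c; split=> //; exact: polygon_winding.
move=> [c' [tc' h]]; apply: winding_number_unique h _; apply: polygon_winding => //.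
by rewrite -(traverses_on_cycle _ tc') (traverses_on_cycle _ tc).
Qed.

(** * Simply connected bases *)

(** The loop is contracted in D, hence in the complement of p. *)
Lemma simply_connected_winding (R : realType) (D : set 'rV[R]_2) (f : R -> 'rV[R]_2) p n :
  simply_connected R D -> {within `[0, 1], continuous f} -> f @` `[0, 1] `<=` D ->
  f 0 = f 1 -> ~ D p -> winding_number f p n -> n = 0.
Proof.
move=> [_ sc] cf fD f01 Dp wf.
have [H [cH HD H0 H1 Hs]] := sc f cf fD f01.
pose h (z : R * R) := (clamp z.1, clamp z.2); pose K := H \o h.
have cK : continuous K.
  apply: (within_comp _ _ cH).
    apply: continuous_pair => z.
      apply: (@continuous_comp _ _ _ (fun z : R * R => z.1) (@clamp R)); last exact: continuous_clamp.
      exact: cvg_fst.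
    apply: (@continuous_comp _ _ _ (fun z : R * R => z.2) (@clamp R)); last exact: continuous_clamp.
    exact: cvg_snd.
  by move=> z; split; rewrite /= in_itv /= clamp01.
have Kp z : K z != p.
  apply/eqP => e; apply: Dp; rewrite -e; apply: HD; exists (clamp z.1, clamp z.2) => //.
  by split; rewrite /= in_itv /= clamp01.
have c0 : clamp 0 = 0 :> R by rewrite clamp_id // lexx ler01.
have c1 : clamp 1 = 1 :> R by rewrite clamp_id // lexx ler01.
have Kl s : K (s, 0) = K (s, 1).
  by rewrite /K /h /= c0 c1; have [-> ->] := Hs _ (clamp01 s).
have K0 : winding_number (fun x => K (0, x)) p n.
  apply: (winding_number_eq _ wf) => x hx; by rewrite /K /h /= c0 H0 ?clamp01 ?clamp_id.
have := winding_number_homotopy cK Kp Kl K0.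
apply: winding_number_const => x.
by rewrite /K /h /= c1 !H1 ?clamp01.
Qed.

Lemma cell_center_cell (R : realType) n (v w : 'rV[int]_n) :
  cell w (cell_center R v) <-> v = w.
Proof.
split=> [h|->]; last first.
  by move=> i; rewrite /cell_center /embed !mxE; apply/andP; split; lra.
apply/rowP => i; have := h i; rewrite /cell_center /embed !mxE.
move=> /andP[h1 h2].
have e1 : (w 0 i)%:~R < (v 0 i + 1)%:~R :> R by rewrite intrD; lra.
have e2 : (v 0 i)%:~R < (w 0 i + 1)%:~R :> R by rewrite intrD; lra.
by rewrite !ltr_int in e1 e2; move: (v 0 i) (w 0 i) e1 e2 => x y; lia.
Qed.

Section Base.
Variables (R : realType) (D : set 'rV[R]_2).
Hypothesis hD : duplex_base D.

Lemma vertices_base : D = \bigcup_(v in [set` vertices D]) @cell R 2 v.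
Proof.
have [[V eD] _ _] := hD; rewrite eD; congr bigcup; rewrite /vertices.
have -> : [set v | cell v `<=` \bigcup_(v in [set` V]) @cell R 2 v] = [set` V].
  rewrite eqEsubset; split => [v /= sv|v vV]; last by apply: bigcup_sup.
  have [] := sv (cell_center R v); first exact/cell_center_cell.
  by move=> w wV /cell_center_cell ->.
by rewrite set_fsetK.
Qed.

Lemma center_base v : D (cell_center R v) <-> v \in vertices D.
Proof.
rewrite {1}vertices_base; split=> [[w wV /cell_center_cell -> //]|vV].
by exists v => //; apply/cell_center_cell.
Qed.

(** The first half of the segment between the centres of two adjacent squares
    lies in the first square, the second half in the other one. *)
Lemma edge_base (u w : 'rV[int]_2) (r : R) : 0 <= r <= 1 ->
  u \in vertices D -> w \in vertices D -> Defs.adjacent u w ->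
  D ((1 - r) *: embed R u + r *: embed R w + const_mx 2^-1).
Proof.
move=> /andP[r0 r1] uV wV uw; rewrite vertices_base.
have st : forall i, w 0 i = u 0 i + 1 \/ w 0 i = u 0 i - 1 \/ w 0 i = u 0 i.
  have h := @adjacent_step _ _ 0 1 isT uw.
  move=> i; have [->|->] := ord2P i.
    by case: h => -[-> _]; auto.
  by case: h => -[_ ->]; auto.
have h2 : (2%:R : R) != 0 by [].
have [rh|rh] := leP r 2^-1.
  exists u => // i; rewrite /embed !mxE; case: (st i) => [->|[->|->]];
    rewrite ?intrD ?intrB; apply/andP; split; lra.
exists w => // i; rewrite /embed !mxE; case: (st i) => [->|[->|->]];
    rewrite ?intrD ?intrB; apply/andP; split; lra.
Qed.

Lemma crossings_outside c g v : traverses c g -> lattice_graph g ->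
  {subset c <= vertices D} -> v \notin vertices D -> v \notin c ->
  crossings 0 1 (v 0 0) (v 0 1 - 1) g = 0.
Proof.
move=> tc lg cV vV vc; have [_ sc _] := hD.
pose f (t : R) : 'rV[R]_2 := polygon c t + const_mx 2^-1.
apply: (simply_connected_winding (f := f) (p := cell_center R v) sc).
- by move=> t; apply: cvgD; [exact: polygon_continuous|exact: cvg_cst].
- move=> _ [t /= ht <-]; rewrite in_itv /= in ht.
  have [u [w [r [hr uc wc uw]]]] := polygon_seg tc lg ht.
  by rewrite /f => ->; apply: edge_base => //; apply: cV.
- by rewrite /f polygon_closed.
- by move/center_base; rewrite (negbTE vV).
apply: (winding_number_eq _ (@polygon_winding R c g tc lg v vc)) => t _.
by rewrite /f /cell_center; apply/rowP => i; rewrite !mxE; ring.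
Qed.

End Base.

(** * Decomposition of a functional graph into cycles *)

Definition functional_graph (A : digraph) : Prop :=
  [/\ forall a b, a \in A -> b \in A -> a.1 = b.1 -> a = b,
      forall a b, a \in A -> b \in A -> a.2 = b.2 -> a = b,
      forall a, a \in A -> exists2 b, b \in A & b.1 = a.2 &
      forall a, a \in A -> exists2 b, b \in A & b.2 = a.1].

Lemma in_cycles (S g : digraph) :
  (g \in cycles S) <-> ((g `<=` S)%fset /\ exists c, traverses c g).
Proof.
rewrite !inE fpowersetE; split=> [/andP[h /asboolP h']|[h h']]; first by split.
by apply/andP; split=> //; apply/asboolP.
Qed.

Section Cycles.
Variable (S : digraph).
Hypothesis fS : functional_graph S.

(** The successor map on the arcs is a permutation, and the orbit of an arc is
    a cycle. *)
Lemma cycle_exists a : a \in S -> exists2 g, g \in cycles S & a \in g.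
Proof.
move=> aS; have [out inn nxt _] := fS.
have /choice [f hf] : forall b : S, exists b' : S, (val b').1 = (val b).2.
  by move=> b; have [b' b'S e] := nxt _ (valP b); exists [` b'S].
have injf : injective f.
  move=> x y e; apply: val_inj; apply: inn; [exact: valP|exact: valP|].
  by rewrite -!hf e.
pose h (b : S) := (val b).1.
have injh : injective h by move=> x y e; apply: val_inj; apply: out => //; exact: valP.
pose x0 : S := [` aS].
pose c := map h (orbit f x0).
have nc b : b \in orbit f x0 -> next c (h b) = (val b).2.
  move=> bo; rewrite (next_map injh) ?orbit_uniq //.
  by rewrite (nextE (cycle_orbit injf x0) bo) /h hf.
pose g : digraph := [fset (x, next c x) | x in c].
have tc : traverses c g.
  split=> //; last by rewrite map_inj_uniq ?orbit_uniq.
  by rewrite -size_eq0 size_map size_orbit -lt0n order_gt0.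
have memg b : b \in orbit f x0 -> val b \in g.
  move=> bo; rewrite (traverses_mem _ tc) nc // eqxx andbT.
  exact: map_f.
exists g; last by apply: (memg x0); rewrite -fconnect_orbit connect0.
apply/in_cycles; split; last by exists c.
apply/fsubsetP => b; rewrite (traverses_mem _ tc) => /andP[/mapP[d dO e] /eqP e'].
have -> : b = val d; last exact: valP.
by rewrite [LHS]surjective_pairing [RHS]surjective_pairing e' e nc.
Qed.

(** A traversal is determined by any of its points, since an arc is determined
    by its source. *)
Lemma cycle_fsubset c c' g g' a : traverses c g -> traverses c' g' ->
  (g `<=` S)%fset -> (g' `<=` S)%fset -> a \in g -> a \in g' -> (g `<=` g')%fset.
Proof.
move=> tc tc' /fsubsetP gS /fsubsetP gS' ag ag'; have [out _ _ _] := fS.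
have nn x : x \in c -> x \in c' -> next c x = next c' x.
  move=> xc xc'.
  have h : (x, next c x) \in g by rewrite (traverses_mem _ tc) /= xc eqxx.
  have h' : (x, next c' x) \in g' by rewrite (traverses_mem _ tc') /= xc' eqxx.
  by have [] := out _ _ (gS _ h) (gS' _ h') erefl.
have ac : a.1 \in c by move: ag; rewrite (traverses_mem _ tc) => /andP[].
have ac' : a.1 \in c' by move: ag'; rewrite (traverses_mem _ tc') => /andP[].
have cc' : {subset c <= c'}.
  have [i s es] := rot_to ac.
  have cy : fcycle (next c) (a.1 :: s) by rewrite -es rot_cycle cycle_next ?(traverses_uniq tc).
  have sc : {subset a.1 :: s <= c} by move=> x; rewrite -es mem_rot.
  have {cy} : fpath (next c) a.1 s by move: cy => /=; rewrite rcons_path => /andP[].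
  move=> ps x; rewrite -(mem_rot i) es.
  elim: s a.1 ac' sc ps x {es ac} => [|y s IH] z zc' sc /=.
    by move=> _ x; rewrite inE => /eqP ->.
  move=> /andP[/eqP ey ps] x; rewrite inE => /orP[/eqP -> //|].
  apply: IH => //; last by move=> w ws; apply: sc; rewrite inE ws orbT.
  by rewrite -ey nn ?mem_next // sc // inE eqxx.
apply/fsubsetP => b bg; have := bg; rewrite (traverses_mem _ tc) => /andP[b1 /eqP b2].
by rewrite (traverses_mem _ tc') cc' //= -nn // ?b2 ?eqxx ?cc'.
Qed.

Lemma cycle_unique g g' a : g \in cycles S -> g' \in cycles S ->
  a \in g -> a \in g' -> g = g'.
Proof.
move=> /in_cycles[gS [c tc]] /in_cycles[gS' [c' tc']] ag ag'.
apply/eqP; rewrite eqEfsubset.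
by rewrite (cycle_fsubset tc tc' gS gS' ag ag') (cycle_fsubset tc' tc gS' gS ag' ag).
Qed.

Lemma sum_cycles (V : zmodType) (F : lattice_arc -> V) :
  \sum_(g <- cycles S) \sum_(a <- g) F a = \sum_(a <- S) F a.
Proof.
transitivity (\sum_(g <- cycles S) \sum_(a <- S) (if a \in g then F a else 0)).
  apply: eq_big_seq => g /in_cycles[gS _].
  rewrite -big_mkcond /= [RHS]big_fset_condE /=; apply: eq_fbig => // a.
  by rewrite !inE /= andb_idl //; apply: (fsubsetP gS).
rewrite exchange_big /=; apply: eq_big_seq => a aS.
have [g gc ag] := cycle_exists aS.
rewrite (big_fsetD1 g) //= ag big1_fset ?addr0 // => g'.
rewrite in_fsetD1 => /andP[/eqP ng gc'] _; case: ifP => // ag'.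
by case: ng; apply: (cycle_unique gc' gc ag' ag).
Qed.

End Cycles.

(** * Winding sums over the cycles of a sock *)

(** [sock t] is [nontrivial_arcs (arcs t)]. *)
Definition nontrivial_arcs (A : digraph) : digraph :=
  [fset a in A | (a.2, a.1) \notin A].

Lemma in_nontrivial (A : digraph) a :
  (a \in nontrivial_arcs A) = (a \in A) && ((a.2, a.1) \notin A).
Proof. by rewrite !inE. Qed.

Section Arcs.
Variables (A : digraph).
Hypotheses (lA : lattice_graph A) (fA : functional_graph A).
Let S := nontrivial_arcs A.

Let SA : {subset S <= A}.
Proof. by move=> a; rewrite in_nontrivial => /andP[]. Qed.

(** An arc that precedes or follows an arc whose reversal is also an arc is this
    reversal. *)
Lemma nontrivial_functional : functional_graph S.
Proof.
have [out inn nxt prv] := fA; split.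
- by move=> a b /SA aA /SA bA; apply: out.
- by move=> a b /SA aA /SA bA; apply: inn.
- move=> a; rewrite in_nontrivial => /andP[aA na]; have [b bA e] := nxt _ aA.
  exists b => //; rewrite in_nontrivial bA /=; apply: contra na => rb.
  by rewrite -(inn _ _ rb aA e) /= -surjective_pairing.
- move=> a; rewrite in_nontrivial => /andP[aA na]; have [b bA e] := prv _ aA.
  exists b => //; rewrite in_nontrivial bA /=; apply: contra na => rb.
  by rewrite -(out _ _ rb aA e) /= -surjective_pairing.
Qed.

Lemma cycles_lattice g : g \in cycles S -> lattice_graph g.
Proof. by move=> /in_cycles[/fsubsetP gS _] a /gS/SA/lA. Qed.

Lemma cycle_noback c g v : (g `<=` S)%fset -> traverses c g -> v \in c ->
  prev c v != next c v.
Proof.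
move=> /fsubsetP gS tc vc; apply/eqP => e.
have h1 : (prev c v, v) \in g by rewrite (mem_in tc).
have h2 : (v, next c v) \in g by rewrite (mem_out tc).
move: (gS _ h1); rewrite in_nontrivial => /andP[_ /=].
by rewrite e (SA (gS _ h2)).
Qed.

(** The arcs whose reversal is also an arc cancel in pairs; the others are those
    of the cycles. *)
Lemma sum_antisymmetric (F : lattice_arc -> int) :
  (forall a, a \in A -> F (a.2, a.1) = - F a) ->
  \sum_(a <- A) F a = \sum_(g <- cycles S) \sum_(a <- g) F a.
Proof.
move=> anti; rewrite (sum_cycles nontrivial_functional).
pose T := [fset a in A | (a.2, a.1) \in A].
have -> : \sum_(a <- A) F a = \sum_(a <- T) F a + \sum_(a <- S) F a.
  by rewrite (big_fsetID _ (fun a => (a.2, a.1) \in A)).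
suff -> : \sum_(a <- T) F a = 0 by rewrite add0r.
have inT a : (a \in T) = (a \in A) && ((a.2, a.1) \in A) by rewrite !inE.
have eT : \sum_(a <- T) F a = - \sum_(a <- T) F a.
  rewrite -sumrN; transitivity (\sum_(a <- [fset (a.2, a.1) | a in T]) F a).
    apply: eq_fbig => // a; apply/idP/imfsetP => [|[b /= +  ->]].
      rewrite inT => /andP[h h']; exists (a.2, a.1); last by case: (a).
      by rewrite /= inT /= h' -surjective_pairing.
    by rewrite !inT /= -surjective_pairing andbC.
  rewrite big_imfset /=; last by move=> [x y] [x' y'] _ _ /= [-> ->].
  by apply: eq_big_seq => a; rewrite inT => /andP[/anti].
by move: eT; move: (\sum_(a <- T) F a) => z; lia.
Qed.

Definition winding_sum (v : 'rV[int]_2) : int :=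
  \sum_(g <- cycles S | ~~ on_cycle v g) crossings 0 1 (v 0 0) (v 0 1 - 1) g.

(** A cycle through one end of an arc contains the arc, and no other cycle
    separates its ends. *)
Lemma winding_sum_step a : a \in A -> winding_sum a.1 = winding_sum a.2.
Proof.
move=> aA; have [out inn _ _] := fA.
rewrite /winding_sum big_mkcond [RHS]big_mkcond; apply: eq_big_seq => g gS.
have lg := cycles_lattice gS; have /in_cycles[/fsubsetP sg [c tc]] := gS.
rewrite !(traverses_on_cycle _ tc).
have -> : (a.2 \in c) = (a.1 \in c).
  apply/idP/idP => h.
    have h1 : (prev c a.2, a.2) \in g by rewrite (mem_in tc).
    by rewrite -(inn _ _ (SA (sg _ h1)) aA erefl) /= mem_prev.
  have h1 : (a.1, next c a.1) \in g by rewrite (mem_out tc).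
  by rewrite -(out _ _ (SA (sg _ h1)) aA erefl) /= mem_next.
case: ifP => // a1c.
have a2c : a.2 \notin c.
  apply: contra a1c => h; have h1 : (prev c a.2, a.2) \in g by rewrite (mem_in tc).
  by rewrite -(inn _ _ (SA (sg _ h1)) aA erefl) /= mem_prev.
have [e1 e2 e3] := crossings_corners tc lg a1c.
have [e1' e2' e3'] := crossings_corners tc lg a2c.
move: e1 e2 e3 e1' e2' e3'.
by case: (@adjacent_step _ _ 0 1 isT (lA aA)) => -[-> ->]; rewrite ?addrK ?subrK; congruence.
Qed.

Lemma color_arc a : a \in A -> color a.2 = - color a.1.
Proof. by move=> /lA; apply: color_adjacent. Qed.

Definition support : {fset 'rV[int]_2} := [fset a.1 | a in A].

Lemma sum_support (F : 'rV[int]_2 -> int) :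
  (\sum_(v <- support) F v = \sum_(a <- A) F a.1) *
  (\sum_(v <- support) F v = \sum_(a <- A) F a.2).
Proof.
have [out inn nxt prv] := fA; split.
  by rewrite big_imfset //= => a b aA bA; apply: out.
transitivity (\sum_(v <- [fset a.2 | a in A]) F v).
  apply: eq_fbig => // v; apply/imfsetP/imfsetP => -[a /= aA ->].
    by have [b bA e] := prv _ aA; exists b.
  by have [b bA e] := nxt _ aA; exists b.
by rewrite big_imfset //= => a b aA bA; apply: inn.
Qed.

(** Summing over the sources and over the targets of the arcs gives the same
    sum with opposite signs. *)
Lemma sum_support0 : \sum_(v <- support) color v * winding_sum v = 0.
Proof.
have e1 := (sum_support (fun v => color v * winding_sum v)).1.
have e2 := (sum_support (fun v => color v * winding_sum v)).2.
have e : \sum_(a <- A) color a.2 * winding_sum a.2 = - \sum_(a <- A) color a.1 * winding_sum a.1.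
  rewrite -sumrN; apply: eq_big_seq => a aA.
  by rewrite -winding_sum_step // color_arc // mulNr.
rewrite e -e1 in e2; move: e2; move: (\sum_(v <- support) _) => z; lia.
Qed.

(** All the cycles avoid v, so they may be replaced by the whole set of arcs, in
    which the trivial cycles do not count. *)
Lemma winding_sum_off v : v \notin support ->
  winding_sum v = crossings 0 1 (v 0 0) (v 0 1 - 1) A /\
  (crossings 0 1 (v 0 0) (v 0 1) A = crossings 0 1 (v 0 0) (v 0 1 - 1) A /\
   crossings 0 1 (v 0 0 - 1) (v 0 1) A = crossings 0 1 (v 0 0) (v 0 1 - 1) A).
Proof.
move=> vA.
have anti p q a : a \in A -> crossing 0 1 p q (a.2, a.1) = - crossing 0 1 p q a.
  by move=> /lA aA; apply: step_crossing_rev; apply: adjacent_step.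
have offc g : g \in cycles S -> exists c, [/\ traverses c g, lattice_graph g & v \notin c].
  move=> gS; have lg := cycles_lattice gS; have /in_cycles[/fsubsetP sg [c tc]] := gS.
  exists c; split=> //; apply: contra vA => vc; apply/imfsetP; exists (v, next c v) => //=.
  by apply/SA/sg; rewrite (mem_out tc).
rewrite /winding_sum /crossings !(sum_antisymmetric (anti _ _)); split.
  rewrite big_mkcond; apply: eq_big_seq => g /offc[c [tc lg vc]].
  by rewrite (traverses_on_cycle _ tc) vc.
by split; apply: eq_big_seq => g /offc[c [tc lg vc]];
  have [] := crossings_corners tc lg vc.
Qed.

Lemma crossings_arcs_swap p q : crossings 1 0 q p A = - crossings 0 1 p q A.
Proof.
rewrite /crossings.
rewrite (@sum_antisymmetric (crossing 1 0 q p)); last first.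
  by move=> a /lA aA; apply: step_crossing_rev; apply: adjacent_step.
rewrite (@sum_antisymmetric (crossing 0 1 p q)); last first.
  by move=> a /lA aA; apply: step_crossing_rev; apply: adjacent_step.
rewrite -sumrN; apply: eq_big_seq => g gS.
have lg := cycles_lattice gS; have /in_cycles[_ [c tc]] := gS.
exact: (crossings_swap tc lg).
Qed.

Lemma sum_arcs_telescope (F : 'rV[int]_2 -> int) : \sum_(a <- A) (F a.2 - F a.1) = 0.
Proof. by rewrite sumrB -(sum_support F).1 -(sum_support F).2 subrr. Qed.

(** [sum_turn] for all the cycles. Each arc of the sock has a unique predecessor,
    and the two arcs of a trivial cycle are parallel. *)
Lemma winding_sum_turn (V : {fset 'rV[int]_2}) :
  (forall g c v, g \in cycles S -> traverses c g -> v \notin c -> v \notin V ->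
     crossings 0 1 (v 0 0) (v 0 1 - 1) g = 0) ->
  4 * \sum_(v <- V) color v * winding_sum v =
  \sum_(a <- A) \sum_(b <- A) (if a.2 == b.1 then color b.1 * vturn a.1 b.1 b.2 else 0).
Proof.
move=> offV; have [out inn nxt prv] := fA.
transitivity (\sum_(g <- cycles S) \sum_(b <- g) \sum_(a <- A)
   (if a.2 == b.1 then color b.1 * vturn a.1 b.1 b.2 else 0)).
  transitivity (\sum_(g <- cycles S) 4 * \sum_(v <- V | ~~ on_cycle v g)
      color v * crossings 0 1 (v 0 0) (v 0 1 - 1) g).
    rewrite -mulr_sumr; congr (_ * _).
    under eq_bigr do rewrite /winding_sum mulr_sumr big_mkcond.
    rewrite exchange_big /=; apply: eq_bigr => g _.
    by rewrite [RHS]big_mkcond.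
  apply: eq_big_seq => g gS.
  have lg := cycles_lattice gS; have /in_cycles[sg [c tc]] := gS.
  under eq_bigl do rewrite (traverses_on_cycle _ tc).
  rewrite (sum_turn tc lg) ?(traverses_sum _ tc); last first.
  - by move=> v vc vV; apply: offV vc vV.
  - by move=> v; apply: cycle_noback sg tc.
  apply: eq_big_seq => v vc /=.
  have h : (prev c v, v) \in g by rewrite (mem_in tc).
  have hA := SA (fsubsetP sg _ h).
  rewrite (big_fsetD1 _ hA) /= eqxx big1_fset ?addr0 // => b.
  rewrite in_fsetD1 => /andP[nb bA] _; case: eqP => // e.
  by rewrite (inn _ _ bA hA e) eqxx in nb.
rewrite (sum_cycles nontrivial_functional) [RHS]exchange_big /=.
rewrite [RHS](big_fsetID _ (fun a => (a.2, a.1) \in A)) /= -/(nontrivial_arcs A) -/S.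
rewrite [X in _ = X + _]big1_fset ?add0r // => b.
rewrite !inE => /andP[bA rb] _; apply: big1_fset => a aA _.
case: eqP => // e; rewrite (inn _ _ aA rb e) /= /vturn /turn; ring.
Qed.

End Arcs.

(** * Tilings as sets of pairs of cubes *)

Definition cubes (d : domino) : seq 'rV[int]_3 := [:: d.1; d.2].

(** The cubes of the region are the two cubes over each vertex. *)
Definition in_slab (V : {fset 'rV[int]_2}) (x : 'rV[int]_3) : bool :=
  (project x \in V) && ((x 0 ord_max == 0) || (x 0 ord_max == 1)).

(** What remains of a tiling once dominoes are pairs of lattice points: a perfect
    matching of the cubes over V into adjacent pairs. *)
Definition lattice_tiling (V : {fset 'rV[int]_2}) (t : {fset domino}) : Prop :=
  [/\ forall d, d \in t -> is_domino d,
      forall d x, d \in t -> x \in cubes d -> in_slab V x,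
      forall x, in_slab V x -> exists2 d, d \in t & x \in cubes d &
      forall d d' x, d \in t -> d' \in t -> x \in cubes d -> x \in cubes d' -> d = d'].

Lemma cell_interior (R : realType) n (x : 'rV[int]_n) :
  (@cell R n x)° (cell_center R x).
Proof.
apply/nbhs_ballP; exists 2^-1 => /=; first by rewrite invr_gt0.
move=> p [_ hp] i; have := hp 0 i; rewrite /ball /= /cell_center /embed !mxE.
rewrite ltr_distlC => /andP[h1 h2]; apply/andP; split; lra.
Qed.

Section Tiling.
Variables (R : realType) (D : set 'rV[R]_2) (t : {fset domino}).
Hypotheses (hD : duplex_base D) (ht : is_tiling (duplex D) t).

Lemma center_duplex x : duplex D (cell_center R x) <-> in_slab (vertices D) x.
Proof.
have -> : duplex D (cell_center R x) <->
   D (cell_center R (project x)) /\ 0 <= cell_center R x 0 ord_max <= 2.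
  rewrite /duplex /=; suff -> : lsubmx (cell_center R x : 'rV_(2 + 1)) = cell_center R (project x) by [].
  by apply/rowP => i; rewrite /cell_center /embed /project !mxE.
have -> : (0 <= cell_center R x 0 ord_max <= 2) = (x 0 ord_max == 0) || (x 0 ord_max == 1).
  rewrite /cell_center /embed !mxE; set z := x 0 ord_max.
  apply/idP/idP => [/andP[h1 h2]|/orP[/eqP ->|/eqP ->]]; [|apply/andP; split; lra..].
  have e1 : (-1)%:~R < z%:~R :> R by rewrite rmorphN1; lra.
  have e2 : z%:~R < 2%:~R :> R by lra.
  by rewrite !ltr_int in e1 e2; lia.
by rewrite (center_base hD) /in_slab; split=> [[-> ->]|/andP[-> ->]].
Qed.

Lemma domino_set_center x d : @domino_set R d (cell_center R x) <-> x \in cubes d.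
Proof.
rewrite /domino_set /cubes !inE; split.
  by move=> [/cell_center_cell ->|/cell_center_cell ->]; rewrite eqxx ?orbT.
by move=> /orP[/eqP ->|/eqP ->]; [left|right]; apply/cell_center_cell.
Qed.

(** The centre of a cube is in no other cube, and it is interior to the dominoes
    that contain the cube. *)
Lemma tiling_lattice : lattice_tiling (vertices D) t.
Proof.
have [dom disj cov] := ht; split=> //.
- move=> d x dt xd; apply/center_duplex; rewrite -cov; exists d => //.
  exact/domino_set_center.
- move=> x /center_duplex; rewrite -cov => -[d dt /domino_set_center xd].
  by exists d.
- move=> d d' x dt d't xd xd'; apply/eqP; apply: contraT => dd'.
  have int e : x \in cubes e -> (@domino_set R e)° (cell_center R x).
    by rewrite !inE => /orP[/eqP ->|/eqP ->]; apply: (filterS _ (cell_interior R _)) => p; [left|right].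
  have : ((@domino_set R d)° `&` (@domino_set R d')°) (cell_center R x).
    by split; apply: int.
  by rewrite disj.
Qed.

End Tiling.

Lemma project0 x : project x 0 0 = x 0 0.
Proof. by rewrite mxE; congr (x _ _); apply/val_inj. Qed.
Lemma project1 x : project x 0 1 = x 0 1.
Proof. by rewrite mxE; congr (x _ _); apply/val_inj. Qed.

Lemma rV3P (x y : 'rV[int]_3) : project x = project y -> x 0 ord_max = y 0 ord_max -> x = y.
Proof.
move=> hp hz; apply/rowP => k.
have [->|[->|->]] : k = 0 \/ k = 1 \/ k = ord_max.
  by case: k => [[|[|[|]]]] // hk; [left|right; left|right; right]; apply/val_inj.
- by rewrite -!project0 hp.
- by rewrite -!project1 hp.
- exact: hz.
Qed.

Lemma white3E (x : 'rV[int]_3) : white x = (2 %| (x 0 0 + x 0 1 + x 0 ord_max)%R)%Z.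
Proof.
rewrite /white !big_ord_recl big_ord0 addr0 addrA.
by congr (_ %| x _ _ + x _ _ + x _ _)%Z; apply/val_inj.
Qed.

Lemma white_project (x : 'rV[int]_3) : white (project x) = (2 %| (x 0 0 + x 0 1)%R)%Z.
Proof. by rewrite whiteE project0 project1. Qed.

Lemma domino_step d : is_domino d ->
  (lattice_step (d.1 0 0) (d.1 0 1) (d.2 0 0) (d.2 0 1) /\ d.2 0 ord_max = d.1 0 ord_max) \/
  [/\ d.2 0 0 = d.1 0 0, d.2 0 1 = d.1 0 1 &
      d.2 0 ord_max = d.1 0 ord_max + 1 \/ d.2 0 ord_max = d.1 0 ord_max - 1].
Proof.
move=> /and3P[_ _ /eqP]; rewrite !big_ord_recl big_ord0 addr0.
have -> : lift ord0 ord0 = 1 :> 'I_3 by apply/val_inj.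
have -> : lift ord0 (lift ord0 ord0) = ord_max :> 'I_3 by apply/val_inj.
move: (d.1 0 0) (d.1 0 1) (d.1 0 ord_max) (d.2 0 0) (d.2 0 1) (d.2 0 ord_max) => a b c a' b' c' h.
have [hc|hc] : c' = c \/ c' <> c by lia.
  by left; split=> //; apply: lattice_step_sqr; rewrite hc subrr expr0n addr0 in h.
by right; split; nia.
Qed.

(** * The arcs of a tiling *)

Section Lattice.
Variables (V : {fset 'rV[int]_2}) (t : {fset domino}).
Hypothesis hT : lattice_tiling V t.

Let tdom d : d \in t -> is_domino d. Proof. by case: hT => h _ _ _; apply: h. Qed.

Lemma slab_height d x : d \in t -> x \in cubes d -> x 0 ord_max = 0 \/ x 0 ord_max = 1.
Proof.
by case: hT => _ h _ _ dt xd; have /andP[_ /orP[/eqP|/eqP]] := h _ _ dt xd; [left|right].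
Qed.

Lemma mem1 d : d.1 \in cubes d. Proof. by rewrite !inE eqxx. Qed.
Lemma mem2 d : d.2 \in cubes d. Proof. by rewrite !inE eqxx orbT. Qed.

Lemma white1 d : d \in t -> white d.1. Proof. by move=> /tdom/and3P[]. Qed.
Lemma black2 d : d \in t -> white d.2 = false.
Proof. by move=> /tdom/and3P[_ /negbTE]. Qed.

(** The two cubes over a vertex have opposite colours. *)
Lemma same_cube d d' x y : d \in t -> d' \in t -> x \in cubes d -> y \in cubes d' ->
  project x = project y -> white x = white y -> x = y.
Proof.
move=> dt d't xd yd hp; apply: contra_eq => nxy.
have : x 0 ord_max <> y 0 ord_max by move=> h; case/eqP: nxy; apply: rV3P.
have := congr1 (fun v : 'rV_2 => v 0 0) hp; have := congr1 (fun v : 'rV_2 => v 0 1) hp.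
rewrite /= !project0 !project1 !white3E.
have := slab_height dt xd; have := slab_height d't yd.
move: (x 0 0) (x 0 1) (x 0 ord_max) (y 0 0) (y 0 1) (y 0 ord_max) => *; apply/eqP; lia.
Qed.

Lemma opposite_cube d x : d \in t -> x \in cubes d ->
  exists d' y, [/\ d' \in t, y \in cubes d', project y = project x &
    white y = ~~ white x /\ y 0 ord_max = 1 - x 0 ord_max].
Proof.
move=> dt xd; have [_ hs hc _] := hT.
pose y : 'rV[int]_3 := \row_k (if k == ord_max then 1 - x 0 ord_max else x 0 k).
have y0 : y 0 0 = x 0 0 by rewrite mxE.
have y1 : y 0 1 = x 0 1 by rewrite mxE.
have y2 : y 0 ord_max = 1 - x 0 ord_max by rewrite mxE eqxx.
have py : project y = project x by apply: rV2P; rewrite ?project0 ?project1.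
have hx := slab_height dt xd.
have [d' d't yd] : exists2 d', d' \in t & y \in cubes d'.
  apply: hc; have /andP[hp _] := hs _ _ dt xd.
  by rewrite /in_slab py hp y2 /=; move: (x 0 ord_max) hx => z; lia.
exists d', y; split=> //; split=> //.
rewrite !white3E y0 y1 y2; move: (x 0 0) (x 0 1) (x 0 ord_max) hx => *; lia.
Qed.

Lemma same_domino d d' x : d \in t -> d' \in t -> x \in cubes d -> x \in cubes d' -> d = d'.
Proof. by case: hT => _ _ _; apply. Qed.

Lemma white_cube d x : d \in t -> x \in cubes d -> white x -> x = d.1.
Proof.
by move=> dt; rewrite !inE => /orP[/eqP //|/eqP ->]; rewrite black2.
Qed.

Lemma black_cube d x : d \in t -> x \in cubes d -> ~~ white x -> x = d.2.
Proof.
by move=> dt; rewrite !inE => /orP[/eqP ->|/eqP //]; rewrite white1.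
Qed.

(** In the top floor the colour of a cube is opposite to that of the vertex
    below it, so both clauses of the orientation go from the black cube to the
    white one. *)
Lemma domino_arcE d : d \in t -> ~~ parallel_k d ->
  domino_arc d = (project d.2, project d.1).
Proof.
move=> dt np; have hz1 := slab_height dt (mem1 d); have hz2 := slab_height dt (mem2 d).
have hw := white1 dt; rewrite white3E in hw.
have [[_ ez]|[e0 e1 _]] := domino_step (tdom dt); last first.
  by case/eqP: np; apply: rV2P; rewrite ?project0 ?project1.
rewrite /domino_arc /top_floor white_project ez andbb.
case: hz1 => hz; rewrite hz in hw *.
  by rewrite addr0 in hw; rewrite hw.
rewrite eqxx; suff -> : (2 %| (d.1 0 0 + d.1 0 1)%R)%Z = false by [].
by move: (d.1 0 0) (d.1 0 1) hw => *; lia.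
Qed.

Lemma in_arcs a : reflect
  (exists2 d, (d \in t) && ~~ parallel_k d & a = (project d.2, project d.1)) (a \in arcs t).
Proof.
rewrite /arcs; apply: (iffP (imfsetP _ _ _ _)) => [[d /=]|[d dt ->]].
  rewrite inE /= => /andP[dt np ->]; exists d; rewrite ?dt ?np //.
  exact: domino_arcE.
exists d; first by rewrite inE.
by case/andP: dt => *; rewrite domino_arcE.
Qed.

Lemma parallel_adjacent d : d \in t ->
  (parallel_k d = false -> Defs.adjacent (project d.2) (project d.1)).
Proof.
move=> dt np; have [[st _]|[e0 e1 _]] := domino_step (tdom dt).
  rewrite /Defs.adjacent !big_ord_recl big_ord0 addr0.
  have -> : lift ord0 ord0 = 1 :> 'I_2 by apply/val_inj.
  rewrite !project0 !project1.
  by case: st => -[-> ->]; apply/eqP; ring.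
by move/eqP: np; case; apply: rV2P; rewrite ?project0 ?project1.
Qed.

Lemma arcs_lattice : lattice_graph (arcs t).
Proof.
by move=> _ /in_arcs[d /andP[dt np] ->]; apply: parallel_adjacent => //; apply/negbTE.
Qed.

(** The two cubes over a vertex under a vertical domino are those of the domino. *)
Lemma parallel_cubes d d' x : d \in t -> parallel_k d -> d' \in t -> x \in cubes d' ->
  project x = project d.1 -> d' = d.
Proof.
move=> dt pd d't xd' hp; apply: (same_domino d't dt xd').
have [wx|bx] := boolP (white x).
  by rewrite (same_cube d't dt xd' (mem1 d) hp) ?mem1 // wx white1.
rewrite (same_cube d't dt xd' (mem2 d)) ?mem2 //; last by rewrite (negbTE bx) black2.
by rewrite hp; apply/eqP.
Qed.

(** The arcs that leave (enter) a vertex come from its black (white) cube, which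
    is in one domino; if one of the two cubes over a vertex is in a vertical
    domino, so is the other. *)
Lemma arcs_functional : functional_graph (arcs t).
Proof.
split.
- move=> _ _ /in_arcs[d /andP[dt _] ->] /in_arcs[d' /andP[d't _] ->] /= e.
  have ed : d.2 = d'.2 by apply: (same_cube dt d't (mem2 d) (mem2 d') e); rewrite !black2.
  by rewrite (same_domino dt d't (mem2 d)) // ed mem2.
- move=> _ _ /in_arcs[d /andP[dt _] ->] /in_arcs[d' /andP[d't _] ->] /= e.
  have ed : d.1 = d'.1 by apply: (same_cube dt d't (mem1 d) (mem1 d') e); rewrite !white1.
  by rewrite (same_domino dt d't (mem1 d)) // ed mem1.
- move=> _ /in_arcs[d /andP[dt np] ->] /=.
  have [d' [y [d't yd' hp [wy _]]]] := opposite_cube dt (mem1 d).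
  have ey : y = d'.2 by apply: black_cube => //; rewrite wy white1.
  exists (project d'.2, project d'.1); last by rewrite /= -ey.
  apply/in_arcs; exists d' => //; rewrite d't /=; apply: contra np => pd'.
  rewrite (@parallel_cubes d' d d.1) ?mem1 // -hp ey; exact/esym/eqP.
- move=> _ /in_arcs[d /andP[dt np] ->] /=.
  have [d' [y [d't yd' hp [wy _]]]] := opposite_cube dt (mem2 d).
  have ey : y = d'.1 by apply: white_cube => //; rewrite wy black2.
  exists (project d'.2, project d'.1); last by rewrite /= -ey.
  apply/in_arcs; exists d' => //; rewrite d't /=; apply: contra np => pd'.
  by rewrite (@parallel_cubes d' d d.2) ?mem2 // -hp ey.
Qed.

Lemma sum_arcs (F : lattice_arc -> int) :
  \sum_(a <- arcs t) F a = \sum_(d <- t | ~~ parallel_k d) F (project d.2, project d.1).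
Proof.
have [out _ _ _] := arcs_functional.
rewrite big_imfset /=; last first.
  move=> d d' /andP[/= dt np] /andP[/= d't np'].
  rewrite !domino_arcE // => -[e _].
  have ed : d.2 = d'.2 by apply: (same_cube dt d't (mem2 d) (mem2 d') e); rewrite !black2.
  by apply: (same_domino dt d't (mem2 d)); rewrite ed mem2.
rewrite big_filter big_seq_cond [RHS]big_seq_cond; apply: eq_bigr => d /andP[dt np].
by rewrite domino_arcE.
Qed.

Lemma parallel_off d : d \in t -> parallel_k d -> project d.1 \notin support (arcs t).
Proof.
move=> dt pd; apply/imfsetP => -[a /= /in_arcs[d' /andP[d't np] ->] /= e].
by move: np; rewrite (parallel_cubes dt pd d't (mem2 d')) ?pd.
Qed.

Lemma support_vertices : {subset support (arcs t) <= V}.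
Proof.
move=> v /imfsetP[a /= /in_arcs[d /andP[dt _] ->] ->] /=.
by have [_ h _ _] := hT; have /andP[] := h _ _ dt (mem2 d).
Qed.

Lemma off_support v : v \in V -> v \notin support (arcs t) ->
  exists2 d, (d \in t) && parallel_k d & v = project d.1.
Proof.
move=> vV vS; have [_ _ hc _] := hT.
pose x : 'rV[int]_3 := \row_k (if k == 0 then v 0 0 else if k == 1 then v 0 1 else 0).
have px : project x = v by apply: rV2P; rewrite ?project0 ?project1 mxE.
have [d dt xd] : exists2 d, d \in t & x \in cubes d.
  by apply: hc; rewrite /in_slab px vV mxE.
have [pd|np] := boolP (parallel_k d).
  exists d; rewrite ?dt // -px; move: xd; rewrite !inE => /orP[/eqP -> //|/eqP ->].
  exact/esym/eqP.
have aA : (project d.2, project d.1) \in arcs t by apply/in_arcs; exists d; rewrite ?dt.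
case/negP: vS; rewrite -px; move: xd; rewrite !inE => /orP[/eqP ->|/eqP ->].
  have [_ _ nxt _] := arcs_functional; have [b bA /= <-] := nxt _ aA.
  by apply/imfsetP; exists b.
by apply/imfsetP; exists (project d.2, project d.1).
Qed.

(** A vertex is under a vertical domino or on an arc, and not both. *)
Lemma sum_vertices (F : 'rV[int]_2 -> int) :
  \sum_(v <- V) F v = \sum_(v <- support (arcs t)) F v
                    + \sum_(d <- t | parallel_k d) F (project d.1).
Proof.
rewrite (bigID (mem (support (arcs t)))) /=; congr (_ + _).
  rewrite big_fset_condE; apply: eq_fbig => // v; rewrite !inE /=.
  by apply/andP/idP => [[]//|vS]; split=> //; apply: support_vertices.
have -> : \sum_(d <- t | parallel_k d) F (project d.1) =
    \sum_(v <- [fset project d.1 | d in t & parallel_k d]) F v.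
  rewrite big_imfset /=; last first.
    move=> d d' /andP[/= dt pd] /andP[/= d't _] e.
    by apply/esym/(parallel_cubes dt pd d't (mem1 d')).
  by rewrite big_filter.
rewrite big_fset_condE; apply: eq_fbig => // v; apply/idP/imfsetP => [|[d /= /andP[/= dt pd] ->]].
  by rewrite !inE /= => /andP[vV vS]; have [d h ->] := off_support vV vS; exists d.
rewrite !inE /= parallel_off // andbT.
by have [_ h _ _] := hT; have /andP[] := h _ _ dt (mem1 d).
Qed.

End Lattice.

(** * Shades and effects *)

Definition axes (a b c : 'I_3) : bool := [&& a != b, b != c & a != c].

Lemma axesP a b c k : axes a b c -> [\/ k = a, k = b | k = c].
Proof.
move=> /and3P[ab bc ac].
have [->|ka] := eqVneq k a; first by apply: Or31.
have [->|kb] := eqVneq k b; first by apply: Or32.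
have [->|kc] := eqVneq k c; first by apply: Or33.
have : uniq [:: a; b; c; k] by rewrite /= !inE !negb_or ab bc ac !(eq_sym _ k) ka kb kc.
by move/card_uniqP => e; have := max_card [in [:: a; b; c; k]]; rewrite e card_ord.
Qed.

(** The cube y is met by the ray from the cube x in the direction of the axis a;
    b and c are the other two axes. *)
Definition ahead (a b c : 'I_3) (x y : 'rV[int]_3) : bool :=
  [&& x 0 b == y 0 b, x 0 c == y 0 c & x 0 a < y 0 a].

Lemma int_lt_inside (R : realType) (m n : int) (r : R) :
  n%:~R < r -> r < n%:~R + 1 -> (m%:~R <= r -> m <= n) /\ (r <= m%:~R + 1 -> n <= m).
Proof.
move=> h1 h2; split=> h3.
  have : m%:~R < (n + 1)%:~R :> R by rewrite intrD; lra.
  by rewrite ltr_int; lia.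
have : n%:~R < (m + 1)%:~R :> R by rewrite intrD; lra.
by rewrite ltr_int; lia.
Qed.

Lemma cell_inside (R : realType) n (x y : 'rV[int]_n) (p : 'rV[R]_n) :
  (forall i, (y 0 i)%:~R < p 0 i < (y 0 i)%:~R + 1) -> cell x p -> x = y.
Proof.
move=> hp hx; apply/rowP => i; have /andP[h1 h2] := hp i; have := hx i.
rewrite /embed mxE => /andP[h3 h4]; have [e1 e2] := int_lt_inside (x 0 i) h1 h2.
by apply/eqP; rewrite eq_le e1 ?e2.
Qed.

Lemma in_domino_set (R : realType) d (p : 'rV[R]_3) :
  domino_set d p <-> exists2 x, x \in cubes d & cell x p.
Proof.
split=> [[h|h]|[x]]; [by exists d.1; rewrite ?mem1|by exists d.2; rewrite ?mem2|].
by rewrite !inE => /orP[/eqP ->|/eqP ->]; [left|right].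
Qed.

(** A point of d1 in the open shade of d0 can be moved towards the centre of its
    cube without leaving the shade, and then it is interior to that cube, which
    therefore has the same projection along a as a cube of d0. Conversely the centre of a cube ahead
    of a cube of d0, and not in d0, is interior to the shade. *)
Lemma shade_meets (R : realType) a b c d0 d1 : axes a b c ->
  (@domino_set R d1 `&` shade (delta_mx 0 a) d0 !=set0) <->
  exists x y, [/\ x \in cubes d0, y \in cubes d1, y \notin cubes d0 & ahead a b c x y].
Proof.
move=> abc; have /and3P[ab bc ac] := abc.
have ba : b != a by rewrite eq_sym.
have ca : c != a by rewrite eq_sym.
split.
  move=> [q [/in_domino_set[y yd1 qy]]].
  rewrite /shade /interior => /nbhs_ballP[e /= e0 he].
  pose s := Num.min 1 e.
  have s0 : 0 < s by rewrite lt_min ltr01.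
  have s1 : s <= 1 by rewrite ge_min lexx.
  have se : s <= e by rewrite ge_min lexx orbT.
  pose q' : 'rV[R]_3 := q + s *: (cell_center R y - q).
  have q'E i : q' 0 i = q 0 i + s * ((y 0 i)%:~R + 2^-1 - q 0 i).
    by rewrite /q' /cell_center /embed !mxE.
  have hq' i : (y 0 i)%:~R < q' 0 i < (y 0 i)%:~R + 1.
    have := qy i; rewrite /embed mxE q'E => /andP[h1 h2]; apply/andP; split; nra.
  have : ball q e q'.
    split=> // i j; rewrite (ord1 i) /ball /= q'E opprD addNKr normrN normrM (gtr0_norm s0).
    have := qy j; rewrite /embed mxE => /andP[h1 h2].
    have h3 : `|(y 0 j)%:~R + 2^-1 - q 0 j| <= 2^-1 by rewrite ler_norml; apply/andP; split; lra.
    have h4 := normr_ge0 ((y 0 j)%:~R + 2^-1 - q 0 j); nra.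
  move=> /he[[z /in_domino_set[x xd0 zx] [r /= r0 eq']] nd0].
  have yd0 : y \notin cubes d0.
    apply/negP => yd0; apply: nd0; apply/in_domino_set; exists y => // i.
    by have /andP[h1 h2] := hq' i; rewrite /embed mxE !ltW.
  have off i : i != a -> x 0 i = y 0 i.
    move=> ia; have := zx i; have /andP[h1 h2] := hq' i; move: h1 h2.
    rewrite -eq' !mxE eqxx (negbTE ia) mulr0 addr0 => h1 h2 /andP[h3 h4].
    have [e1 e2] := int_lt_inside (x 0 i) h1 h2.
    by apply/eqP; rewrite eq_le e1 ?e2.
  exists x, y; split=> //; rewrite /ahead (off b ba) (off c ca) !eqxx /=.
  have xy : x 0 a <= y 0 a.
    have := zx a; have /andP[h1 h2] := hq' a; move: h1 h2.
    rewrite -eq' !mxE !eqxx mulr1 => h1 h2 /andP[h3 h4].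
    by have [e1 _] := int_lt_inside (x 0 a) h1 h2; apply: e1; lra.
  rewrite lt_neqAle xy andbT; apply: contraNneq yd0 => exy.
  suff <- : x = y by [].
  by apply/rowP => i; have [->|/off] := eqVneq i a.
move=> [x [y [xd0 yd1 yd0 /and3P[/eqP eb /eqP ec lxy]]]].
exists (cell_center R y); split.
  by apply/in_domino_set; exists y => //; apply/cell_center_cell.
apply/nbhs_ballP; exists 2^-1; first by rewrite /= invr_gt0.
move=> p [_ hp].
have hp' i : (y 0 i)%:~R < p 0 i < (y 0 i)%:~R + 1.
  have := hp 0 i; rewrite /ball /= /cell_center /embed !mxE ltr_distlC => /andP[h1 h2].
  by apply/andP; split; lra.
split; last first.
  move=> /in_domino_set[x' x'd0 /(cell_inside hp') ex]; by rewrite -ex x'd0 in yd0.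
exists (p - (y 0 a - x 0 a)%:~R *: delta_mx 0 a).
  apply/in_domino_set; exists x => // i; rewrite /embed !mxE eqxx /= intrB.
  have /andP[h1 h2] := hp' i.
  case: (axesP i abc) => ei; subst i; rewrite ?eqxx ?(negbTE ba) ?(negbTE ca) ?mulr1 ?mulr0 ?subr0 ?eb ?ec;
  apply/andP; split; lra.
exists ((y 0 a - x 0 a)%:~R); last by rewrite subrK.
by rewrite /= ler0z subr_ge0 ltW.
Qed.

Definition dvec (d : domino) (k : 'I_3) : int := d.2 0 k - d.1 0 k.

Definition shadow_count (a b c : 'I_3) (d0 d1 : domino) : int :=
  \sum_(x <- cubes d0) \sum_(y <- cubes d1) ind (ahead a b c x y).

Lemma shadow_countE a b c d0 d1 : shadow_count a b c d0 d1 =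
  ind (ahead a b c d0.1 d1.1) + ind (ahead a b c d0.1 d1.2)
  + (ind (ahead a b c d0.2 d1.1) + ind (ahead a b c d0.2 d1.2)).
Proof. by rewrite /shadow_count /cubes !big_cons !big_nil !addr0. Qed.

Lemma shadow_countC a b c d0 d1 : shadow_count a b c d0 d1 = shadow_count a c b d0 d1.
Proof.
by rewrite !shadow_countE /ahead; do !congr (_ + _); congr ind; rewrite andbCA.
Qed.

Lemma domino_axis d b c : is_domino d -> b != c -> dvec d c != 0 -> dvec d b = 0.
Proof.
move=> /and3P[_ _ /eqP]; rewrite /dvec (bigD1 c) //= => + bc cn.
rewrite (bigD1 b) //=; set s := \sum_(i | _) _.
have s0 : 0 <= s by apply: sumr_ge0 => *; exact: sqr_ge0.
move: cn; move: (d.1 0 b) (d.2 0 b) (d.1 0 c) (d.2 0 c) => x x' y y' cn h.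
nia.
Qed.

(** If d0 is parallel to c and d1 to b, then their projections along a share at
    most one square, so the count is 0 or 1. *)
Lemma shadow_count_generic a b c d0 d1 : axes a b c -> is_domino d0 -> is_domino d1 ->
  dvec d0 c != 0 -> dvec d1 b != 0 ->
  shadow_count a b c d0 d1 =
  ind (has (fun x => has (fun y => (y \notin cubes d0) && ahead a b c x y) (cubes d1)) (cubes d0)).
Proof.
move=> /and3P[ab bc ac] dom0 dom1 n0 n1.
have e0a := domino_axis dom0 ac n0; have e0b := domino_axis dom0 bc n0.
have e1a := domino_axis dom1 ab n1.
have e1c : dvec d1 c = 0 by apply: (domino_axis dom1 _ n1); rewrite eq_sym.
have notin x y : x \in cubes d0 -> ahead a b c x y -> y \notin cubes d0.
  move=> xd /and3P[_ _ xy]; apply/negP => yd.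
  have e z : z \in cubes d0 -> z 0 a = d0.1 0 a.
    by rewrite !inE => /orP[/eqP ->|/eqP ->] //; move/eqP: e0a; rewrite subr_eq0 => /eqP.
  by move: xy; rewrite (e x) ?(e y) ?ltxx.
have simp x y : x \in cubes d0 -> (y \notin cubes d0) && ahead a b c x y = ahead a b c x y.
  by move=> xd; rewrite andb_idl //; apply: notin.
rewrite shadow_countE /= !orbF !simp ?mem1 ?mem2 //.
move: n0 n1 e0a e0b e1a e1c; rewrite /dvec /ahead.
move: (d0.1 0 a) (d0.1 0 b) (d0.1 0 c) (d0.2 0 a) (d0.2 0 b) (d0.2 0 c)
  (d1.1 0 a) (d1.1 0 b) (d1.1 0 c) (d1.2 0 a) (d1.2 0 b) (d1.2 0 c).
move=> x0 y0 z0 x1 y1 z1 x0' y0' z0' x1' y1' z1' n0 n1 e1 e2 e3 e4.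
have -> : x1 = x0 by lia.
have -> : y1 = y0 by lia.
have -> : x1' = x0' by lia.
have -> : z1' = z0' by lia.
clear -n0 n1; case: (x0 < x0'); rewrite ?andbT ?andbF //.
have h1 : ~~ ((y0 == y0') && (y0 == y1')) by lia.
have h2 : ~~ ((z0 == z0') && (z1 == z0')) by lia.
by move: h1 h2; case: (y0 == y0'); case: (y0 == y1'); case: (z0 == z0'); case: (z1 == z0').
Qed.

Section Effect.
Variable R : realType.

Lemma det3E (p q r : 'rV[R]_3) : det3 p q r =
  p 0 0 * (q 0 1 * r 0 ord_max - q 0 ord_max * r 0 1)
  - p 0 1 * (q 0 0 * r 0 ord_max - q 0 ord_max * r 0 0)
  + p 0 ord_max * (q 0 0 * r 0 1 - q 0 1 * r 0 0).
Proof.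
rewrite /det3 (expand_det_row _ ord0) !big_ord_recl big_ord0 /cofactor.
rewrite !(expand_det_row _ ord0) !big_ord_recl !big_ord0 /cofactor !det_mx11 !mxE /=.
have ord3 (k l : 'I_3) : val k = val l -> k = l by move=> ?; apply/val_inj.
repeat match goal with |- context [fun_of_matrix ?m ?i (lift ?h ?k)] =>
  first [ rewrite (ord3 (lift h k) 0 erefl) | rewrite (ord3 (lift h k) 1 erefl)
        | rewrite (ord3 (lift h k) ord_max erefl) ] end.
rewrite (ord3 ord0 0 erefl) /bump /=; ring.
Qed.

Lemma domino_vecE (d : domino) k : domino_vec R d 0 k = (dvec d k)%:~R.
Proof. by rewrite /domino_vec /cell_center /embed !mxE /dvec intrB; ring. Qed.

(** The determinant vanishes unless one of the two dominoes is parallel to b and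
    the other to c, and in that case the count is the indicator of the shade. *)
Lemma effect_count a b c d0 d1 : axes a b c -> is_domino d0 -> is_domino d1 ->
  det3 (domino_vec R d1) (domino_vec R d0) (delta_mx 0 a) =
    (dvec d1 b * dvec d0 c - dvec d1 c * dvec d0 b)%:~R ->
  effect (delta_mx 0 a) d0 d1 = 4^-1 *
    (shadow_count a b c d0 d1 * (dvec d1 b * dvec d0 c - dvec d1 c * dvec d0 b))%:~R :> R.
Proof.
move=> abc dom0 dom1 edet; rewrite /effect edet.
set D := _ - _.
have [->|D0] := eqVneq D 0; first by rewrite mulr0 !mulr0; case: ifP.
have -> : shadow_count a b c d0 d1 = ind (`[< (@domino_set R d1 `&` shade (delta_mx 0 a) d0 !=set0)%classic >]).
  have -> : `[< (@domino_set R d1 `&` shade (delta_mx 0 a) d0 !=set0)%classic >] =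
    has (fun x => has (fun y => (y \notin cubes d0) && ahead a b c x y) (cubes d1)) (cubes d0).
    apply/asboolP/hasP => [/(shade_meets _ _ _ abc)[x [y [xd yd nyd xy]]]|[x xd /hasP[y yd /andP[nyd xy]]]].
      by exists x => //; apply/hasP; exists y; rewrite ?nyd.
    by apply/(shade_meets _ _ _ abc); exists x, y.
  have : (dvec d1 b != 0) && (dvec d0 c != 0) || (dvec d1 c != 0) && (dvec d0 b != 0).
    apply: contraNT D0; rewrite negb_or !negb_and !negbK /D.
    by move=> /andP[/orP[/eqP->|/eqP->] /orP[/eqP->|/eqP->]]; rewrite ?mul0r ?mulr0 subrr.
  case/orP => /andP[h1 h2]; first exact: shadow_count_generic.
  rewrite shadow_countC shadow_count_generic //; last first.
    by move: abc => /and3P[? ? ?]; rewrite /axes; apply/and3P; split => //; rewrite eq_sym.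
  congr ind; apply: eq_has => x; apply: eq_has => y; congr (_ && _).
  by rewrite /ahead andbCA.
by case: ifP => _; rewrite /ind ?mul1r ?mul0r ?mulr0.
Qed.

End Effect.

(** * Pretwists as sums over arcs *)

Definition pair_sum (a b c : 'I_3) (t : {fset domino}) : int :=
  \sum_(d0 <- t) \sum_(d1 <- t)
    shadow_count a b c d0 d1 * (dvec d1 b * dvec d0 c - dvec d1 c * dvec d0 b).

Lemma pretwist_count (R : realType) (t : {fset domino}) :
  (forall d, d \in t -> is_domino d) ->
  [/\ pretwist (vec_i R) t = 4^-1 * (pair_sum 0 1 ord_max t)%:~R,
      pretwist (vec_j R) t = 4^-1 * (pair_sum 1 ord_max 0 t)%:~R &
      pretwist (vec_k R) t = 4^-1 * (pair_sum ord_max 0 1 t)%:~R].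
Proof.
move=> dom.
have gen a b c : axes a b c ->
    (forall d0 d1, det3 (domino_vec R d1) (domino_vec R d0) (delta_mx 0 a) =
    (dvec d1 b * dvec d0 c - dvec d1 c * dvec d0 b)%:~R) ->
    pretwist (delta_mx 0 a) t = 4^-1 * (pair_sum a b c t)%:~R :> R.
  move=> abc edet; rewrite /pretwist /pair_sum rmorph_sum mulr_sumr.
  apply: eq_big_seq => d0 d0t; rewrite rmorph_sum mulr_sumr; apply: eq_big_seq => d1 d1t.
  by apply: effect_count => //; apply: dom.
by split; apply: gen => // d0 d1; rewrite det3E !domino_vecE !mxE /= ?eqxx [in RHS]intrB !intrM; ring.
Qed.

Lemma pair_sum_swap a b c t : pair_sum a b c t = - pair_sum a c b t.
Proof.
rewrite /pair_sum -sumrN; apply: eq_bigr => d0 _; rewrite -sumrN; apply: eq_bigr => d1 _.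
rewrite (shadow_countC a b); ring.
Qed.

(** A cube is level with exactly one of the two cubes of a vertical domino. *)
Lemma one_floor (p q : bool) (z z' z'' : int) : z = 0 \/ z = 1 ->
  (z' = 0 /\ z'' = 1) \/ (z' = 1 /\ z'' = 0) ->
  (ind [&& p, z' == z & q] + ind [&& p, z'' == z & q] = ind (q && p)) *
  (ind [&& p, z == z' & q] + ind [&& p, z == z'' & q] = ind (q && p)).
Proof. by case: p; case: q; case=> -> [[-> ->]|[-> ->]]. Qed.

Section Rows.
Variables (V : {fset 'rV[int]_2}) (t : {fset domino}).
Hypothesis hT : lattice_tiling V t.
Variables (i j : 'I_2).
Hypothesis ij : i != j.

Let a : 'I_3 := lshift 1 i.
Let b : 'I_3 := lshift 1 j.
Let C p q := crossings i j p q (arcs t).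

Let projE (x : 'rV[int]_3) : (project x 0 i = x 0 a) * (project x 0 j = x 0 b).
Proof. by rewrite /project !mxE. Qed.

Lemma parallel_shape d : d \in t -> parallel_k d ->
  [/\ d.2 0 a = d.1 0 a, d.2 0 b = d.1 0 b &
      (d.1 0 ord_max = 0 /\ d.2 0 ord_max = 1) \/ (d.1 0 ord_max = 1 /\ d.2 0 ord_max = 0)].
Proof.
move=> dt /eqP pd; rewrite -!projE pd; split=> //.
have := slab_height hT dt (mem1 d); have := slab_height hT dt (mem2 d).
have : d.1 0 ord_max <> d.2 0 ord_max.
  move=> e; have := white1 hT dt; have := black2 hT dt.
  by rewrite (rV3P pd e) => ->.
by move: (d.1 0 ord_max) (d.2 0 ord_max) => x y *; lia.
Qed.

(** The white cube is the lower one exactly over a white vertex. *)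
Lemma parallel_color d : d \in t -> parallel_k d ->
  dvec d ord_max = - color (project d.1).
Proof.
move=> dt pd; have [_ _ hz] := parallel_shape dt pd.
have hw := white1 hT dt; rewrite white3E in hw.
rewrite /dvec /color white_project.
move: hw hz; move: (d.1 0 0) (d.1 0 1) (d.1 0 ord_max) (d.2 0 ord_max) => *.
by case: ifP; lia.
Qed.

Lemma dvec_height d : d \in t -> ~~ parallel_k d -> dvec d ord_max = 0.
Proof.
move=> dt np; rewrite /dvec.
have [[_ ->]|[e0 e1 _]] := domino_step (let: And4 h _ _ _ := hT in h d dt); first by rewrite subrr.
by case/eqP: np; apply: rV2P; rewrite ?project0 ?project1.
Qed.

Lemma dvec_parallel d : parallel_k d -> dvec d b = 0.
Proof. by move=> /eqP pd; rewrite /dvec -!projE pd subrr. Qed.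

Lemma shadow_from d0 d1 : d0 \in t -> d1 \in t -> parallel_k d0 ->
  let w := project d0.1 in
  let f (v : 'rV[int]_2) := ind ((w 0 i < v 0 i) && (v 0 j == w 0 j)) in
  shadow_count a b ord_max d0 d1 = f (project d1.1) + f (project d1.2).
Proof.
move=> d0t d1t pd w f; have [e1 e2 hz] := parallel_shape d0t pd.
have h1 := slab_height hT d1t (mem1 d1); have h2 := slab_height hT d1t (mem2 d1).
rewrite shadow_countE /f /w !projE /ahead e1 e2 addrACA; congr (_ + _).
  by rewrite [_ == d0.1 0 b]eq_sym (one_floor _ _ h1 hz).1.
by rewrite [_ == d0.1 0 b]eq_sym (one_floor _ _ h2 hz).1.
Qed.

Lemma shadow_to d0 d1 : d0 \in t -> d1 \in t -> parallel_k d1 ->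
  let w := project d1.1 in
  let f (v : 'rV[int]_2) := ind ((v 0 i < w 0 i) && (v 0 j == w 0 j)) in
  shadow_count a b ord_max d0 d1 = f (project d0.1) + f (project d0.2).
Proof.
move=> d0t d1t pd w f; have [e1 e2 hz] := parallel_shape d1t pd.
have h1 := slab_height hT d0t (mem1 d0); have h2 := slab_height hT d0t (mem2 d0).
rewrite shadow_countE /f /w !projE /ahead e1 e2; congr (_ + _).
  by rewrite (one_floor _ _ h1 hz).2.
by rewrite (one_floor _ _ h2 hz).2.
Qed.

Lemma sum_dvec (f : 'rV[int]_2 -> int) :
  \sum_(d <- t) dvec d b * (f (project d.1) + f (project d.2)) =
  - \sum_(x <- arcs t) (x.2 0 j - x.1 0 j) * (f x.1 + f x.2).
Proof.
rewrite (sum_arcs hT (fun x => (x.2 0 j - x.1 0 j) * (f x.1 + f x.2))) -sumrN.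
rewrite [RHS]big_mkcond; apply: eq_bigr => d _.
case: ifP => /= [_|/negbFE pd]; last by rewrite dvec_parallel ?mul0r.
by rewrite !projE -mulNr opprB [f (project d.2) + _]addrC.
Qed.

Let step x : x \in arcs t -> lattice_step (x.1 0 i) (x.1 0 j) (x.2 0 i) (x.2 0 j).
Proof. by move=> /(arcs_lattice hT); apply: adjacent_step. Qed.

Lemma row_from d : d \in t -> parallel_k d ->
  \sum_(d1 <- t) dvec d1 b * shadow_count a b ord_max d d1 =
  - (C (project d.1 0 i) (project d.1 0 j) + C (project d.1 0 i) (project d.1 0 j - 1)).
Proof.
move=> dt pd; set w := project d.1.
transitivity (\sum_(d1 <- t) dvec d1 b *
  (ind ((w 0 i < (project d1.1) 0 i) && ((project d1.1) 0 j == w 0 j)) +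
   ind ((w 0 i < (project d1.2) 0 i) && ((project d1.2) 0 j == w 0 j)))).
  by apply: eq_big_seq => d1 d1t; rewrite (shadow_from dt d1t pd).
rewrite (sum_dvec (fun v => ind ((w 0 i < v 0 i) && (v 0 j == w 0 j)))).
rewrite /C /crossings -big_split; congr (- _); apply: eq_big_seq => x /step.
exact: step_crossing_right.
Qed.

(** The full lines that appear in [step_crossing_row] are crossed 0 times, by
    telescoping. *)
Lemma row_to d : d \in t -> parallel_k d ->
  \sum_(d0 <- t) dvec d0 b * shadow_count a b ord_max d0 d =
  C (project d.1 0 i) (project d.1 0 j) + C (project d.1 0 i) (project d.1 0 j - 1).
Proof.
move=> dt pd; set w := project d.1.
transitivity (\sum_(d0 <- t) dvec d0 b *
  (ind (((project d0.1) 0 i < w 0 i) && ((project d0.1) 0 j == w 0 j)) +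
   ind (((project d0.2) 0 i < w 0 i) && ((project d0.2) 0 j == w 0 j)))).
  by apply: eq_big_seq => d0 d0t; rewrite (shadow_to d0t dt pd).
rewrite (sum_dvec (fun v => ind ((v 0 i < w 0 i) && (v 0 j == w 0 j)))).
have off := parallel_off hT dt pd.
have ne (v : 'rV[int]_2) : v \in support (arcs t) -> ~ (v 0 i = w 0 i /\ v 0 j = w 0 j).
  move=> vS [hi hj]; move: off; rewrite -/w (_ : w = v) ?vS //.
  by apply: rV2P; case: (ord2_cases ij) hi hj => -[-> ->] hi hj; rewrite ?hi ?hj.
transitivity (- (- (C (w 0 i) (w 0 j) + C (w 0 i) (w 0 j - 1))
   + \sum_(x <- arcs t) (ind (w 0 j < x.2 0 j) - ind (w 0 j < x.1 0 j))
   + \sum_(x <- arcs t) (ind (w 0 j - 1 < x.2 0 j) - ind (w 0 j - 1 < x.1 0 j)))).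
  congr (- _); rewrite /C /crossings -big_split /= -sumrN -!big_split /=.
  apply: eq_big_seq => x xA; apply: step_crossing_row; first exact: step.
    by apply: ne; apply/imfsetP; exists x.
  apply: ne; have [_ _ nxt _] := arcs_functional hT; have [y yA <-] := nxt _ xA.
  by apply/imfsetP; exists y.
have fA := arcs_functional hT.
rewrite (sum_arcs_telescope fA (fun v => ind (w 0 j < v 0 j))).
by rewrite (sum_arcs_telescope fA (fun v => ind (w 0 j - 1 < v 0 j))) !addr0 opprK.
Qed.

(** The vertical domino of a pair may cast the shade or be in the shade of the
    other one; the two cases contribute equally. *)
Lemma row_sum : pair_sum a b ord_max t =
  2 * \sum_(d <- t | parallel_k d) color (project d.1) *
    (C (project d.1 0 i) (project d.1 0 j) + C (project d.1 0 i) (project d.1 0 j - 1)).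
Proof.
transitivity (\sum_(d0 <- t) dvec d0 ord_max *
    \sum_(d1 <- t) dvec d1 b * shadow_count a b ord_max d0 d1
  - \sum_(d1 <- t) dvec d1 ord_max * \sum_(d0 <- t) dvec d0 b * shadow_count a b ord_max d0 d1).
  rewrite /pair_sum; under [X in _ = _ - X]eq_bigr do rewrite mulr_sumr.
  rewrite [X in _ = _ - X]exchange_big /= -sumrB; apply: eq_bigr => d0 _.
  by rewrite mulr_sumr -sumrB; apply: eq_bigr => d1 _; ring.
rewrite -sumrB mulr_sumr [RHS]big_mkcond; apply: eq_big_seq => d dt.
case: ifP => pd; last by rewrite dvec_height ?pd // !mul0r subrr.
rewrite row_from // row_to // parallel_color //; ring.
Qed.

End Rows.

Lemma sum_symmetrize (T : Type) (r : seq T) (F : T -> T -> int) :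
  \sum_(x <- r) \sum_(y <- r) (F x y + F y x) = 2 * \sum_(x <- r) \sum_(y <- r) F x y.
Proof.
under eq_bigr do rewrite big_split.
rewrite big_split /= [X in _ + X]exchange_big /=; ring.
Qed.

Section Vertical.
Variables (V : {fset 'rV[int]_2}) (t : {fset domino}).
Hypothesis hT : lattice_tiling V t.

Lemma ahead_same_color d d' x y : d \in t -> d' \in t -> x \in cubes d -> y \in cubes d' ->
  white x = white y -> ahead ord_max 0 1 x y = false.
Proof.
move=> dt d't xd yd hw; apply/negP => /and3P[/eqP e0 /eqP e1 lt].
suff exy : x = y by rewrite exy ltxx in lt.
by apply: (same_cube hT dt d't xd yd _ hw); apply: rV2P; rewrite ?project0 ?project1.
Qed.

(** The cubes d.1 and d'.2 have opposite colours, so they are on different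
    floors when they have the same projection. *)
Lemma ahead_color d d' : d \in t -> d' \in t ->
  (if project d.1 == project d'.2 then color (project d'.2) else 0) =
  ind (ahead ord_max 0 1 d'.2 d.1) - ind (ahead ord_max 0 1 d.1 d'.2).
Proof.
move=> dt d't; have w := white1 hT dt; have b := black2 hT d't.
have h := slab_height hT dt (mem1 d); have h' := slab_height hT d't (mem2 d').
rewrite rV2_eqE !project0 !project1 /color white_project /ahead.
rewrite [d'.2 0 0 == _]eq_sym [d'.2 0 1 == _]eq_sym.
rewrite !white3E in w b; move: w b h h'.
move: (d.1 0 0) (d.1 0 1) (d.1 0 ord_max) (d'.2 0 0) (d'.2 0 1) (d'.2 0 ord_max).
move=> x y z x' y' z' w b h h'.
have [e|] //= := eqVneq x x'; subst x'; have [e|] //= := eqVneq y y'; subst y'.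
by rewrite /ind; repeat case: ifP; lia.
Qed.

(** Two dominoes one above the other along k share a vertex where one of their
    arcs ends and the other begins. Which of the two is on top is told by the
    colour of this vertex, and this is the sign between the two determinants. *)
Lemma pair_sum_vertical : pair_sum ord_max 0 1 t =
  \sum_(a <- arcs t) \sum_(b <- arcs t)
    (if a.2 == b.1 then color b.1 * vturn a.1 b.1 b.2 else 0).
Proof.
(* The term of the arc of d followed by the arc of d'. *)
pose Q (d d' : domino) : int :=
  (if project d.1 == project d'.2 then color (project d'.2) else 0) *
  (dvec d 0 * dvec d' 1 - dvec d 1 * dvec d' 0).
have par d : parallel_k d -> dvec d 0 = 0 /\ dvec d 1 = 0.
  by move=> /eqP e; rewrite /dvec; split; rewrite -?project0 -?project1 -e ?project0 ?project1 subrr.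
transitivity (\sum_(d <- t) \sum_(d' <- t) Q d d'); last first.
  rewrite (sum_arcs hT (fun a => \sum_(b <- arcs t)
    (if a.2 == b.1 then color b.1 * vturn a.1 b.1 b.2 else 0))) [RHS]big_mkcond.
  apply: eq_bigr => d _; case: ifP => [_|/negbFE /par[e0 e1]]; last first.
    by rewrite big1 // => d1 _; rewrite /Q e0 e1 !mul0r ?subrr ?mulr0.
  rewrite (sum_arcs hT (fun b => if project d.1 == b.1 then
      color b.1 * vturn (project d.2) b.1 b.2 else 0)) [RHS]big_mkcond.
  apply: eq_bigr => d' _; case: ifP => [_|/negbFE /par[e0 e1]]; last first.
    by rewrite /Q e0 e1 !mulr0 ?subrr ?mulr0.
  rewrite /Q /=; case: eqP => [e|_]; last by rewrite mul0r.
  have e0 : d.1 0 0 = d'.2 0 0 by rewrite -!project0 e.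
  have e1 : d.1 0 1 = d'.2 0 1 by rewrite -!project1 e.
  by congr (_ * _); rewrite /vturn /turn !project0 !project1 /dvec e0 e1; ring.
(* The count of a pair in its two orders detects its two possible junctions. *)
have sym : \sum_(d0 <- t) \sum_(d1 <- t)
    (shadow_count ord_max 0 1 d0 d1 * (dvec d1 0 * dvec d0 1 - dvec d1 1 * dvec d0 0)
     + shadow_count ord_max 0 1 d1 d0 * (dvec d0 0 * dvec d1 1 - dvec d0 1 * dvec d1 0)) =
  \sum_(d0 <- t) \sum_(d1 <- t) (Q d0 d1 + Q d1 d0).
  apply: eq_big_seq => d0 d0t; apply: eq_big_seq => d1 d1t.
  rewrite /Q !ahead_color // !shadow_countE.
  have sc x y : x \in cubes d0 -> y \in cubes d1 -> white x = white y ->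
      (ahead ord_max 0 1 x y = false) * (ahead ord_max 0 1 y x = false).
    by move=> xd yd w; rewrite (ahead_same_color d0t d1t xd yd w) (ahead_same_color d1t d0t yd xd).
  rewrite !(sc d0.1 d1.1) ?mem1 ?white1 // ?(white1 hT d0t) ?(white1 hT d1t) //.
  rewrite !(sc d0.2 d1.2) ?mem2 // ?(black2 hT d0t) ?(black2 hT d1t) //.
  rewrite /ind; ring.
pose F (d0 d1 : domino) :=
  shadow_count ord_max 0 1 d0 d1 * (dvec d1 0 * dvec d0 1 - dvec d1 1 * dvec d0 0).
have := sum_symmetrize t Q; rewrite -sym (sum_symmetrize t F) -/(pair_sum _ _ _ t).
by move=> /(mulfI (isT : (2 : int) != 0)).
Qed.

End Vertical.

(** * The derivative at 1 *)

(** Both [laurent_deriv] and [sock_poly] are given as sums of monomials whose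
    exponents may coincide. *)
Lemma coef_sum (I : choiceType) (s : seq I) (c k : I -> int) (w : int -> int) :
  let P : laurent := \sum_(i <- s) << c i *g k i >> in
  \sum_(x <- msupp P) w x * P@_x = \sum_(i <- s) w (k i) * c i.
Proof.
move=> P; pose K : {fset int} := (msupp P `|` [fset k i | i in s])%fset.
rewrite (big_fset_incl _ (fsubsetUl _ [fset k i | i in s])) -/K; last first.
  by move=> x _ /mcoeff_outdom ->; rewrite mulr0.
transitivity (\sum_(x <- K) \sum_(i <- s) (if k i == x then w x * c i else 0)).
  apply: eq_bigr => x _; rewrite /P raddf_sum mulr_sumr; apply: eq_bigr => i _ /=.
  by rewrite mcoeffU mulrb; case: eqP; rewrite ?mulr0.
rewrite exchange_big /=; apply: eq_big_seq => i si.
have kK : k i \in K by rewrite in_fsetU; apply/orP; right; apply/imfsetP; exists i.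
rewrite (big_fsetD1 _ kK) /= eqxx big1_fset ?addr0 // => x.
by rewrite in_fsetD1 eq_sym => /andP[/negbTE ->].
Qed.

Lemma laurent_deriv1 (R : realType) (I : choiceType) (s : seq I) (c k : I -> int) :
  laurent_eval (laurent_deriv (\sum_(i <- s) << c i *g k i >>)) (1 : R) =
  (\sum_(i <- s) c i * k i)%:~R.
Proof.
have ev (f : laurent) : laurent_eval f (1 : R) = (\sum_(x <- msupp f) 1 * f@_x)%:~R.
  rewrite /laurent_eval rmorph_sum; apply: eq_bigr => x _.
  by rewrite exp1rz mulr1 mul1r.
rewrite ev /laurent_deriv; set P := \sum_(i <- s) _.
rewrite (coef_sum (msupp P) (fun x => x * P@_x) (fun x => x - 1) (fun=> 1)).
under eq_bigr do rewrite mul1r.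
rewrite (coef_sum s c k id); congr (_%:~R).
by apply: eq_bigr => i _; rewrite mulrC.
Qed.

Theorem proposition1 (R : realType) (D : set 'rV[R]_2) (t : {fset domino}) :
  duplex_base D -> is_tiling (duplex D) t ->
  [/\ laurent_eval (laurent_deriv (sock_poly D t)) (1 : R) = pretwist (vec_i R) t,
      pretwist (vec_i R) t = pretwist (vec_j R) t &
      pretwist (vec_j R) t = pretwist (vec_k R) t].
Proof.
move=> hD ht; have hT := tiling_lattice hD ht.
have lA := arcs_lattice hT; have fA := arcs_functional hT.
set V := vertices D in hT *.
pose L := \sum_(v <- V) color v * winding_sum (arcs t) v.
have lhs : laurent_eval (laurent_deriv (sock_poly D t)) (1 : R) = L%:~R.
  rewrite /sock_poly laurent_deriv1; congr (_%:~R); apply: eq_bigr => v _.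
  congr (_ * _); rewrite /winding_sum big_seq_cond [RHS]big_seq_cond.
  apply: eq_bigr => g /andP[gS vg].
  have lg := cycles_lattice lA gS; have /in_cycles[_ [c tc]] := gS.
  by apply: (wind_crossings R tc lg); rewrite -(traverses_on_cycle _ tc).
have LJ : L = \sum_(d <- t | parallel_k d) color (project d.1) * winding_sum (arcs t) (project d.1).
  by rewrite /L (sum_vertices hT) (sum_support0 lA fA) add0r.
have off d : d \in t -> parallel_k d -> project d.1 \notin support (arcs t).
  by move=> dt pd; exact: (parallel_off hT dt pd).
have ei : pair_sum 0 1 ord_max t = 4 * L.
  have := row_sum hT (isT : (0 : 'I_2) != 1).
  have -> : lshift 1 (0 : 'I_2) = 0 :> 'I_3 by apply/val_inj.
  have -> : lshift 1 (1 : 'I_2) = 1 :> 'I_3 by apply/val_inj.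
  move=> ->; rewrite LJ !mulr_sumr big_seq_cond [RHS]big_seq_cond.
  apply: eq_bigr => d /andP[dt pd].
  have [-> [-> _]] := winding_sum_off lA fA (off _ dt pd); ring.
have ej : pair_sum 1 ord_max 0 t = 4 * L.
  rewrite pair_sum_swap; have := row_sum hT (isT : (1 : 'I_2) != 0).
  have -> : lshift 1 (0 : 'I_2) = 0 :> 'I_3 by apply/val_inj.
  have -> : lshift 1 (1 : 'I_2) = 1 :> 'I_3 by apply/val_inj.
  move=> ->; rewrite LJ !mulr_sumr -sumrN big_seq_cond [RHS]big_seq_cond.
  apply: eq_bigr => d /andP[dt pd]; rewrite !(crossings_arcs_swap lA fA).
  have [-> [-> ->]] := winding_sum_off lA fA (off _ dt pd); ring.
have ek : pair_sum ord_max 0 1 t = 4 * L.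
  rewrite (pair_sum_vertical hT) -(winding_sum_turn lA fA (V := V)) // => g c v gS tc vc vV.
  apply: (crossings_outside hD tc (cycles_lattice lA gS)) => // x xc.
  have /in_cycles[/fsubsetP gA _] := gS.
  apply: (support_vertices hT); apply/imfsetP; exists (x, next c x) => //=.
  by have := gA _ (_ : (x, next c x) \in g); rewrite (mem_out tc) // in_nontrivial => /(_ (eqxx _))/andP[].
have dom d : d \in t -> is_domino d by case: hT => h _ _ _; apply: h.
have [-> -> ->] := pretwist_count R dom.
have h4 : (4 : R) != 0 by [].
by rewrite lhs ei ej ek; split=> //; rewrite intrM mulrA mulVf ?mul1r.
Qed.
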